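(* Let $(X,d)$ be a u.l.f. metric space, $h\colon X\to\mathbb{R}$ a coarse map, and $\beta\ge 0$. There are strongly continuous $(\sigma_h,\beta)$-KMS states on $\mathrm{C}^*_u(X)$ if and only if $Z(\beta):=\sum_{x\in X}e^{-\beta h(x)}<\infty$. Moreover, a function $\varphi\colon\mathrm{C}^*_u(X)\to\mathbb{C}$ is a strongly continuous $(\sigma_h,\beta)$-KMS state on $\mathrm{C}^*_u(X)$ if and only if $$\varphi(a)=\frac{1}{Z(\beta)}\sum_{x\in X}a_{x,x}e^{-\beta h(x)}$$ for all $a=[a_{x,y}]\in\mathrm{C}^*_u(X)$. In particular, whenever they exist, strongly continuous $(\sigma_h,\beta)$-KMS states are unique.
   Context: A metric space is u.l.f. if for every $r>0$ the cardinalities of its balls of radius $r$ are uniformly bounded. With $(\delta_x)$ the canonical basis of $\ell_2(X)$ and $a_{x,y}=\langle a\delta_y,\delta_x\rangle$, $\mathrm{C}^*_u(X)$ is the norm closure of the $^*$-algebra of operators $a$ with $\sup\{d(x,y):a_{x,y}\neq0\}<\infty$. $h$ is coarse if for each $r>0$ there is $s>0$ with $d(x,y)<r\Rightarrow|h(x)-h(y)|<s$. $\sigma_{h,t}(a)=e^{it\bar h}ae^{-it\bar h}$ where $e^{it\bar h}\delta_x=e^{ith(x)}\delta_x$; this is a flow on $\mathrm{C}^*_u(X)$. $b$ is analytic if $t\mapsto\sigma_{h,t}(b)$ extends to an entire map $z\mapsto\sigma_{h,z}(b)$; a state $\varphi$ is $(\sigma_h,\beta)$-KMS if $\varphi(a\sigma_{h,i\beta}(b))=\varphi(ba)$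 for all $a$ and all analytic $b$. A state is strongly continuous if it is continuous on bounded subsets of $\mathrm{C}^*_u(X)$ with respect to the strong operator topology. *)

(* Defs.v *)
From mathcomp Require Import all_boot all_algebra.
From mathcomp Require Import all_classical all_reals all_analysis finmap.
From mathcomp.real_closed Require Import complex.
Set Implicit Arguments. Unset Strict Implicit. Unset Printing Implicit Defensive.
Import GRing.Theory Num.Theory.
Local Open Scope ring_scope.

Section UniformRoe.
Variables (R : realType) (X : choiceType).
Local Notation C := R[i].

Definition RtoC (r : R) : C := Complex r 0.
Definition expi (t : R) : C := Complex (cos t) (sin t).

Definition is_metric (d : X -> X -> R) : Prop :=
  [/\ forall x y, 0 <= d x y,
      forall x y, d x y = 0 <-> x = y,
      forall x y, d x y = d y x &
      forall x y z, d x z <= d x y + d y z].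

Definition ulf (d : X -> X -> R) : Prop :=
  forall r : R, 0 < r -> exists N : nat, forall (x : X) (s : seq X),
    uniq s -> all (fun y => d x y <= r) s -> (size s <= N)%N.

Definition coarse (d : X -> X -> R) (h : X -> R) : Prop :=
  forall r : R, 0 < r -> exists s : R, 0 < s /\
    forall x y, d x y < r -> `|h x - h y| < s.

Definition hasSum (f : X -> C) (S : C) : Prop :=
  forall e : C, 0 < e -> exists F0 : {fset X}, forall F : {fset X},
    fsubset F0 F -> `| \sum_(x <- F) f x - S | < e.

(** The sum of a summable family (an arbitrary value otherwise). *)
Definition sumX (f : X -> C) : C := xget 0 [set S | hasSum f S].

Definition l2 (xi : X -> C) : Prop := exists S, hasSum (fun x => `|xi x| ^+ 2) S.
Definition l2norm2 (xi : X -> C) : C := sumX (fun x => `|xi x| ^+ 2).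

(** Operators on l2(X) are represented by their matrices
    a x y = < a delta_y, delta_x >. *)
Definition mx := X -> X -> C.

(** ||a|| <= M, tested on finitely supported vectors u, v:
    |<u, a v>| <= M ||u|| ||v||  (squared). *)
Definition op_bound (a : mx) (M : C) : Prop :=
  0 <= M /\
  forall (F : {fset X}) (u v : X -> C),
    `| \sum_(x <- F) \sum_(y <- F) (u x)^* * a x y * v y | ^+ 2
      <= M ^+ 2 * (\sum_(x <- F) `|u x| ^+ 2) * (\sum_(y <- F) `|v y| ^+ 2).

Definition bounded_op (a : mx) : Prop := exists M, op_bound a M.

Definition mx_add (a b : mx) : mx := fun x y => a x y + b x y.
Definition mx_sub (a b : mx) : mx := fun x y => a x y - b x y.
Definition mx_scale (c : C) (a : mx) : mx := fun x y => c * a x y.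
Definition mx_mul (a b : mx) : mx := fun x z => sumX (fun y => a x y * b y z).
Definition mx_adj (a : mx) : mx := fun x y => (a y x)^*.
Definition mx_one : mx := fun x y => if x == y then 1 else 0.
Definition mx_diag (f : X -> C) : mx := fun x y => if x == y then f x else 0.
Definition mx_apply (a : mx) (xi : X -> C) : X -> C :=
  fun x => sumX (fun y => a x y * xi y).

Definition finite_prop (d : X -> X -> R) (a : mx) : Prop :=
  exists r : R, forall x y, a x y != 0 -> d x y <= r.

Definition Cu (d : X -> X -> R) : set mx :=
  [set a | bounded_op a /\ forall e : C, 0 < e ->
     exists b, [/\ bounded_op b, finite_prop d b & op_bound (mx_sub a b) e]].

Definition sigma (h : X -> R) (t : R) (a : mx) : mx :=
  mx_mul (mx_diag (fun x => expi (t * h x)))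
         (mx_mul a (mx_diag (fun x => expi (- (t * h x))))).

Definition entire (d : X -> X -> R) (F : C -> mx) : Prop :=
  (forall z, Cu d (F z)) /\
  forall z0 : C, exists D : mx, forall e : C, 0 < e -> exists delta : C, 0 < delta /\
    forall z : C, 0 < `|z - z0| < delta ->
      op_bound (mx_sub (mx_scale (z - z0)^-1 (mx_sub (F z) (F z0))) D) e.

(** F is an entire extension of t |-> sigma_{h,t}(b); b is analytic iff such
    an F exists, and then sigma_{h,z}(b) = F z. *)
Definition entire_ext (d : X -> X -> R) (h : X -> R) (b : mx) (F : C -> mx) : Prop :=
  entire d F /\ forall t : R, F (RtoC t) = sigma h t b.

Definition is_state (d : X -> X -> R) (phi : mx -> C) : Prop :=
  [/\ forall a b, Cu d a -> Cu d b -> phi (mx_add a b) = phi a + phi b,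
      forall c a, Cu d a -> phi (mx_scale c a) = c * phi a,
      forall a, Cu d a -> 0 <= phi (mx_mul (mx_adj a) a) &
      phi mx_one = 1].

Definition is_KMS (d : X -> X -> R) (h : X -> R) (beta : R) (phi : mx -> C) : Prop :=
  forall (b : mx) (F : C -> mx), Cu d b -> entire_ext d h b F ->
    forall a, Cu d a -> phi (mx_mul a (F ('i * RtoC beta))) = phi (mx_mul b a).

Definition strongly_continuous (d : X -> X -> R) (phi : mx -> C) : Prop :=
  forall B : set mx, (forall b, B b -> Cu d b) -> (exists M, forall b, B b -> op_bound b M) ->
  forall a, B a -> forall e : C, 0 < e ->
    exists (xis : seq (X -> C)) (delta : C),
      [/\ all (fun xi => `[< l2 xi >]) xis, 0 < delta &
       forall b, B b ->
         (forall xi, xi \in xis -> l2norm2 (mx_apply (mx_sub b a) xi) < delta ^+ 2) ->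
         `| phi b - phi a | < e].

Definition sc_KMS_state d h beta (phi : mx -> C) : Prop :=
  [/\ is_state d phi, strongly_continuous d phi & is_KMS d h beta phi].

Definition Zpart (h : X -> R) (beta : R) : \bar R :=
  (\esum_(x in [set: X]) (expR (- (beta * h x)))%:E)%E.

Definition gibbs (h : X -> R) (beta : R) (a : mx) : C :=
  sumX (fun x => a x x * RtoC (expR (- (beta * h x)))) / RtoC (fine (Zpart h beta)).

End UniformRoe.

(* Main.v *)
(** If phi is a KMS state, the KMS condition for the matrix units e_xy, on which the
    flow acts by the scalars e^{it(h x - h y)}, gives
    phi(a e_xx) = a_xx phi(e_xx) and phi(e_xx) = c e^{-beta h x} with c constant.
    The compressions of a to finitely many columns are bounded and converge strongly to a,
    so strong continuity yields phi(a) = c sum_x a_xx e^{-beta h x};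
    taking a = 1 gives c Z(beta) = 1.

    Conversely, that the Gibbs formula is KMS follows by exchanging a double sum once
    one knows that sigma_{i beta}(b)_xy = e^{-beta (h x - h y)} b_xy for every entire extension
    of the flow. Entrywise this says that an everywhere complex-differentiable f vanishing on
    the real line vanishes at i beta. By Goursat's theorem F(z) = int_0^w f(z + t) dt has
    second-order Taylor expansions, so |F p^n|^2 + |z|^2 has no interior maximum, p a polynomial.
    Choose p with |p| <= 1 on the three sides, off the real line, of a rectangle around i beta
    and |p(i beta)| > 1: letting n grow forces F(i beta) = 0, and then w -> 0. *)

Require Import Defs.
From mathcomp Require Import all_boot all_order all_algebra.
From mathcomp Require Import all_classical all_reals all_analysis finmap.
From mathcomp.real_closed Require Import complex.
From mathcomp Require Import ring lra.
Set Implicit Arguments. Unset Strict Implicit. Unset Printing Implicit Defensive.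
Import Order.TTheory GRing.Theory Num.Theory.
Import numFieldNormedType.Exports.
Local Open Scope classical_set_scope.
Local Open Scope ring_scope.

(** * The modulus of a complex number *)

Section ComplexModulus.
Variable R : realType.
Local Notation C := R[i].
Local Notation Re := (@complex.Re R).
Local Notation Im := (@complex.Im R).
Implicit Types (z w : C) (r s : R).

(** The KMS condition quantifies over every entire extension of the flow, so checking it for the
    Gibbs formula requires that all extensions agree at i beta; this is where the complex analysis
    is spent. An entry of an extension is only known to have a complex derivative at each point,
    with no continuity of that derivative, whereas a maximum principle that compares a point with
    its neighbours needs second-order expansions. The integral F has derivative f(z + w) - f(z),
    which is differentiable again; Goursat's theorem makes its vertical increments computable like
    the horizontal ones. The polynomial p may exceed 1 on the real side because F vanishes there.
    The added |z|^2 makes the comparison with the neighbours strict, and it costs a constant that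
    depends on the rectangle but not on n, whereas a nonzero F(i beta) would make |F p^n|^2 grow
    geometrically at i beta. *)

Definition cmod z : R := Re `|z|.

(** The norm and the order of [C] are complex-valued. Working with the real number [cmod z] turns
    estimates into real inequalities, within reach of [lra] and [nra]. *)
Lemma normE z : `|z| = RtoC (cmod z).
Proof. by rewrite /cmod normc_def. Qed.

Lemma cmod_sqr z : cmod z ^+ 2 = Re z ^+ 2 + Im z ^+ 2.
Proof. by rewrite /cmod normc_def /= sqr_sqrtr // addr_ge0 // sqr_ge0. Qed.

Lemma cmod_ge0 z : 0 <= cmod z.
Proof. by rewrite /cmod normc_def /= sqrtr_ge0. Qed.

Lemma RtoC_inj : injective (@RtoC R).
Proof. by move=> x y []. Qed.

Lemma RtoC_le r s : (RtoC r <= RtoC s) = (r <= s).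
Proof. exact: lecR. Qed.

Lemma RtoC_lt r s : (RtoC r < RtoC s) = (r < s).
Proof. exact: ltcR. Qed.

Lemma RtoCD r s : RtoC (r + s) = RtoC r + RtoC s.
Proof. exact: (rmorphD (real_complex R)). Qed.

Lemma RtoCB r s : RtoC (r - s) = RtoC r - RtoC s.
Proof. exact: (rmorphB (real_complex R)). Qed.

Lemma RtoCN r : RtoC (- r) = - RtoC r.
Proof. exact: (rmorphN (real_complex R)). Qed.

Lemma RtoCM r s : RtoC (r * s) = RtoC r * RtoC s.
Proof. exact: (rmorphM (real_complex R)). Qed.

Lemma RtoCX r n : RtoC (r ^+ n) = RtoC r ^+ n.
Proof. exact: (rmorphXn (real_complex R)). Qed.

Lemma RtoCV r : RtoC r^-1 = (RtoC r)^-1.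
Proof. exact: (fmorphV (real_complex R)). Qed.

Lemma RtoC0 : RtoC 0 = 0 :> C. Proof. by []. Qed.
Lemma RtoC1 : RtoC 1 = 1 :> C. Proof. by []. Qed.

Lemma RtoC_sum (I : Type) (s : seq I) (P : pred I) (F : I -> R) :
  RtoC (\sum_(i <- s | P i) F i) = \sum_(i <- s | P i) RtoC (F i).
Proof. exact: (rmorph_sum (real_complex R)). Qed.

Lemma gt0_RtoC z : 0 < z -> exists2 r, z = RtoC r & 0 < r.
Proof.
case: z => a b; rewrite ltcE /= => /andP[/eqP -> a0].
by exists a.
Qed.

Lemma ge0_RtoC z : 0 <= z -> exists2 r, z = RtoC r & 0 <= r.
Proof.
case: z => a b; rewrite lecE /= => /andP[/eqP -> a0].
by exists a.
Qed.

Lemma cmod0 : cmod 0 = 0. Proof. by rewrite /cmod normr0. Qed.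
Lemma cmod1 : cmod 1 = 1. Proof. by rewrite /cmod normr1. Qed.

Lemma cmodM z w : cmod (z * w) = cmod z * cmod w.
Proof. by apply: RtoC_inj; rewrite RtoCM -!normE normrM. Qed.

Lemma cmodN z : cmod (- z) = cmod z.
Proof. by rewrite /cmod normrN. Qed.

Lemma cmodBC z w : cmod (z - w) = cmod (w - z).
Proof. by rewrite /cmod distrC. Qed.

Lemma cmodX z n : cmod (z ^+ n) = cmod z ^+ n.
Proof. by apply: RtoC_inj; rewrite RtoCX -!normE normrX. Qed.

Lemma cmodV z : cmod z^-1 = (cmod z)^-1.
Proof. by apply: RtoC_inj; rewrite RtoCV -!normE normfV. Qed.

Lemma cmodD z w : cmod (z + w) <= cmod z + cmod w.
Proof. by rewrite -RtoC_le RtoCD -!normE ler_normD. Qed.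

Lemma cmodB z w : cmod (z - w) <= cmod z + cmod w.
Proof. by rewrite (le_trans (cmodD _ _)) // cmodN. Qed.

Lemma cmod_sum (I : Type) (s : seq I) (P : pred I) (F : I -> C) :
  cmod (\sum_(i <- s | P i) F i) <= \sum_(i <- s | P i) cmod (F i).
Proof.
elim/big_rec2: _ => [|i y z _ H]; first by rewrite cmod0.
by rewrite (le_trans (cmodD _ _))// lerD2l.
Qed.

Lemma cmod_eq0 z : (cmod z == 0) = (z == 0).
Proof. by rewrite -(inj_eq RtoC_inj) -normE normr_eq0. Qed.

Lemma cmod_eq0P z : cmod z = 0 -> z = 0.
Proof. by move/eqP; rewrite cmod_eq0 => /eqP. Qed.

Lemma cmod_gt0 z : z != 0 -> 0 < cmod z.
Proof. by rewrite lt_def cmod_eq0 cmod_ge0 andbT. Qed.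

Lemma cmodR r : cmod (RtoC r) = `|r|.
Proof. by rewrite /cmod normc_def /= expr0n addr0 sqrtr_sqr. Qed.

Lemma cmodRp r : 0 <= r -> cmod (RtoC r) = r.
Proof. by move=> r0; rewrite cmodR ger0_norm. Qed.

Lemma iE : 'i = Complex 0 1 :> C.
Proof. by rewrite -complexiE. Qed.

Lemma cmodi : cmod 'i = 1.
Proof. by rewrite iE /cmod normc_def /= expr0n expr1n add0r sqrtr1. Qed.

Lemma conjE z : z^* = Complex (Re z) (- Im z).
Proof.
by case: z.
Qed.

Lemma cmodJ z : cmod z^* = cmod z.
Proof. by rewrite /cmod norm_conjC. Qed.

Lemma cmodJM z : z^* * z = RtoC (cmod z ^+ 2).
Proof. by rewrite RtoCX -normE mulrC normCK. Qed.

Lemma cmod_Re z : `|Re z| <= cmod z.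
Proof.
rewrite -ler_sqr ?nnegrE ?cmod_ge0// cmod_sqr real_normK ?num_real//.
by rewrite lerDl sqr_ge0.
Qed.

Lemma cmod_Im z : `|Im z| <= cmod z.
Proof.
rewrite -ler_sqr ?nnegrE ?cmod_ge0// cmod_sqr real_normK ?num_real//.
by rewrite lerDr sqr_ge0.
Qed.

Lemma complexRI z : z = RtoC (Re z) + 'i * RtoC (Im z).
Proof.
case: z => a b; rewrite iE; apply/eqP; rewrite eq_complex /=.
by apply/andP; split; apply/eqP; ring.
Qed.

Lemma cmod_le z : cmod z <= `|Re z| + `|Im z|.
Proof.
rewrite {1}(complexRI z) (le_trans (cmodD _ _))// cmodM cmodi mul1r.
by rewrite !cmodR.
Qed.

Lemma ReD z w : Re (z + w) = Re z + Re w. Proof. by case: z w => ? ? []. Qed.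
Lemma ImD z w : Im (z + w) = Im z + Im w. Proof. by case: z w => ? ? []. Qed.
Lemma ReN z : Re (- z) = - Re z. Proof. by case: z. Qed.
Lemma ImN z : Im (- z) = - Im z. Proof. by case: z. Qed.

Lemma small_eq0 r : 0 <= r -> (forall e, 0 < e -> r <= e) -> r = 0.
Proof.
move=> r0 H; apply/eqP; rewrite eq_le r0 andbT leNgt; apply/negP => rp.
have /H : 0 < r / 2 by lra.
by lra.
Qed.

Lemma cmod_small_eq0 z : (forall e, 0 < e -> cmod z <= e) -> z = 0.
Proof. by move=> H; apply/cmod_eq0P/small_eq0 => //; exact: cmod_ge0. Qed.

End ComplexModulus.

(** * Integrals of complex-valued functions of a real variable *)

Section RealIntegral.
Variable R : realType.
Implicit Types (f g : R -> R) (a b c : R).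

Definition rint f a b : R := \int[@lebesgue_measure R]_(x in `[a, b]) f x.

Lemma rint_integrable f a b : continuous f ->
  (@lebesgue_measure R).-integrable `[a, b] (EFin \o f).
Proof.
move=> cf; apply: continuous_compact_integrable; first exact: segment_compact.
exact: continuous_subspaceT.
Qed.

Lemma rint_chasles f a b c : continuous f -> a <= b -> b <= c ->
  rint f a c = rint f a b + rint f b c.
Proof.
move=> cf ab bc.
have i1 := rint_integrable a c cf.
rewrite /rint -(@Rintegral_itv_obnd_cbnd R b (BRight c)); last first.
  apply: integrableS (rint_integrable b c cf) => //.
  by apply: subset_itvr; rewrite bnd_simp.
rewrite -(@Rintegral_itvB _ _ (BLeft a) (BRight c) b) ?bnd_simp//.
by rewrite addrC subrK.
Qed.

Lemma rintD f g a b : continuous f -> continuous g ->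
  rint (fun x => f x + g x) a b = rint f a b + rint g a b.
Proof. by move=> cf cg; rewrite /rint RintegralD//; exact: rint_integrable. Qed.

Lemma rintZ f a b c : continuous f ->
  rint (fun x => c * f x) a b = c * rint f a b.
Proof. by move=> cf; rewrite /rint RintegralZl//; exact: rint_integrable. Qed.

Lemma rint_cst c a b : a <= b -> rint (fun=> c) a b = c * (b - a).
Proof.
move=> ab; rewrite /rint Rintegral_cst// [X in fine X](lebesgue_measure_itv `[a, b]) /= lte_fin.
case: ltP => [//|ba]; have -> : b = a by apply/eqP; rewrite eq_le ab ba.
by rewrite subrr.
Qed.

Lemma rint_id a b : a <= b -> rint id a b = (b ^+ 2 - a ^+ 2) / 2.
Proof.
rewrite le_eqVlt => /predU1P[->|ab].
  by rewrite subrr mul0r /rint set_itv1 Rintegral_set1.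
rewrite /rint /Rintegral.
have dF (x : R) : is_derive x 1 (fun y : R => y ^+ 2 / 2) x.
  by apply: is_derive_eq; rewrite /GRing.scale /=; lra.
have cF : continuous (fun y : R => y ^+ 2 / 2).
  by move=> x; apply/differentiable_continuous/derivable1_diffP; exact: ex_derive.
rewrite (@continuous_FTC2 R id (fun x => x ^+ 2 / 2)) //.
- by rewrite -EFinB/=; ring.
- by apply: continuous_subspaceT => x; exact: cvg_id.
- split.
  + by move=> x _; exact: ex_derive.
  + exact/cvg_at_right_filter/cF.
  + exact/cvg_at_left_filter/cF.
- by move=> x _; rewrite derive1E derive_val.
Qed.

Lemma rint_le f a b m : continuous f -> a <= b ->
  (forall x, a <= x <= b -> `|f x| <= m) -> `|rint f a b| <= m * (b - a).
Proof.
move=> cf ab H; rewrite -rint_cst//.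
apply: (le_trans (le_normr_Rintegral _ _)) => //; first exact: rint_integrable.
apply: le_Rintegral => //.
- apply: (@rint_integrable (fun x => `|f x|)).
  by move=> x; apply: cvg_norm; exact: cf.
- by apply: (@rint_integrable (fun=> m)) => x; exact: cvg_cst.
Qed.

Lemma eq_rint f g a b : (forall x, a <= x <= b -> f x = g x) ->
  rint f a b = rint g a b.
Proof.
move=> H; apply: eq_Rintegral => x /set_mem /=; rewrite in_itv /=; exact: H.
Qed.

End RealIntegral.

Section ComplexIntegral.
Variable R : realType.
Local Notation C := R[i].
Local Notation Re := (@complex.Re R).
Local Notation Im := (@complex.Im R).
Implicit Types (f g : R -> C) (a b c : R) (k l : C).

(** Spelled out with [cmod] rather than through a topology on [C]; [path_cont_comp] converts it to
    topological continuity of the real and imaginary parts, which the integral needs. *)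
Definition path_cont f := forall t e, 0 < e ->
  exists2 del, 0 < del & forall s, `|s - t| < del -> cmod (f s - f t) < e.

Lemma path_cont_comp f (p : C -> R) : path_cont f ->
  (forall z w, `|p z - p w| <= cmod (z - w)) -> continuous (p \o f).
Proof.
move=> cf lp t; apply/cvgrPdist_lt => e e0.
have [del d0 H] := cf t e e0.
near=> s; rewrite /= (le_lt_trans (lp _ _))// cmodBC H// distrC.
Unshelve. all: by end_near.
Qed.

Lemma path_cont_Re f : path_cont f -> continuous (Re \o f).
Proof.
by move=> /path_cont_comp; apply => z w; rewrite -ReN -ReD cmod_Re.
Qed.

Lemma path_cont_Im f : path_cont f -> continuous (Im \o f).
Proof.
by move=> /path_cont_comp; apply => z w; rewrite -ImN -ImD cmod_Im.
Qed.

Lemma path_contD f g : path_cont f -> path_cont g ->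
  path_cont (fun t => f t + g t).
Proof.
move=> cf cg t e e0; have e2 : 0 < e / 2 by lra.
have [d1 d10 H1] := cf t _ e2; have [d2 d20 H2] := cg t _ e2.
exists (Num.min d1 d2); first by rewrite lt_min d10.
move=> s; rewrite lt_min => /andP[/H1 h1 /H2 h2].
rewrite opprD addrACA (le_lt_trans (cmodD _ _))//; lra.
Qed.

Lemma path_contZ k f : path_cont f -> path_cont (fun t => k * f t).
Proof.
(* The [+ 1] keeps the divisor positive when [k] is zero; the same device recurs below. *)
move=> cf t e e0; have k0 : 0 < cmod k + 1 by rewrite ltr_wpDl// cmod_ge0.
have [del d0 H] := cf t (e / (cmod k + 1)) (divr_gt0 e0 k0).
exists del => // s /H; rewrite -mulrBr cmodM ltr_pdivlMr// => h.
apply: le_lt_trans h; rewrite mulrC ler_wpM2l ?cmod_ge0//; lra.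
Qed.

Lemma path_cont_cst k : path_cont (fun=> k).
Proof. by move=> t e e0; exists 1 => // s _; rewrite subrr cmod0. Qed.

Lemma path_cont_id : path_cont (@RtoC R).
Proof. by move=> t e e0; exists e => // s; rewrite -RtoCB cmodR. Qed.

Definition cint f a b : C := Complex (rint (Re \o f) a b) (rint (Im \o f) a b).

Lemma cint_chasles f a b c : path_cont f -> a <= b -> b <= c ->
  cint f a c = cint f a b + cint f b c.
Proof.
move=> cf ab bc; rewrite /cint (rint_chasles (path_cont_Re cf) ab bc).
by rewrite (rint_chasles (path_cont_Im cf) ab bc).
Qed.

Lemma cintD f g a b : path_cont f -> path_cont g ->
  cint (fun t => f t + g t) a b = cint f a b + cint g a b.
Proof.
move=> cf cg; rewrite /cint.
have := rintD a b (path_cont_Re cf) (path_cont_Re cg).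
have := rintD a b (path_cont_Im cf) (path_cont_Im cg).
rewrite /comp => h1 h2.
by under eq_rint do rewrite ReD; under [X in Complex _ X]eq_rint do rewrite ImD;
  rewrite h1 h2.
Qed.

Lemma cintZ k f a b : path_cont f ->
  cint (fun t => k * f t) a b = k * cint f a b.
Proof.
move=> cf; rewrite /cint; case: k => x y.
have cR := path_cont_Re cf; have cI := path_cont_Im cf.
have cZ (u : R) h : continuous h -> continuous (fun t : R => u * h t).
  by move=> ch t; apply: cvgMr; exact: ch.
rewrite (@eq_rint _ _ (fun t => x * Re (f t) + (- y) * Im (f t))); last first.
  by move=> t _ /=; case: (f t) => p q /=; ring.
rewrite (@eq_rint _ (Im \o _) (fun t => x * Im (f t) + y * Re (f t))); last first.
  by move=> t _ /=; case: (f t) => p q /=; ring.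
rewrite (rintD _ _ (cZ x _ cR) (cZ (- y) _ cI)).
rewrite (rintD _ _ (cZ x _ cI) (cZ y _ cR)).
rewrite !rintZ//; apply/eqP; rewrite eq_complex /=.
by apply/andP; split; apply/eqP; ring.
Qed.

Lemma cint_cst k a b : a <= b -> cint (fun=> k) a b = k * RtoC (b - a).
Proof.
move=> ab; rewrite /cint /comp !rint_cst//; case: k => x y.
by apply/eqP; rewrite eq_complex /=; apply/andP; split; apply/eqP; ring.
Qed.

Lemma cint_id a b : a <= b ->
  cint (@RtoC R) a b = RtoC ((b ^+ 2 - a ^+ 2) / 2).
Proof. by move=> ab; rewrite /cint /comp /= rint_id// rint_cst// mul0r. Qed.

(** The factor 2 comes from estimating the real and imaginary parts separately; no later argument
    needs the sharp constant. *)
Lemma cint_le f a b m : path_cont f -> a <= b ->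
  (forall x, a <= x <= b -> cmod (f x) <= m) ->
  cmod (cint f a b) <= 2 * m * (b - a).
Proof.
move=> cf ab H; rewrite (le_trans (cmod_le _))//= -mulrA mulr_natl mulr2n.
by apply: lerD; apply: rint_le => //;
  [exact: path_cont_Re | move=> x /H; apply: le_trans; exact: cmod_Re
  |exact: path_cont_Im | move=> x /H; apply: le_trans; exact: cmod_Im].
Qed.

Lemma eq_cint f g a b : (forall x, a <= x <= b -> f x = g x) ->
  cint f a b = cint g a b.
Proof. by move=> H; congr Complex; apply: eq_rint => x /H /= ->. Qed.

Lemma cint_affine k l a b : a <= b ->
  cint (fun t => k + l * RtoC t) a b =
  k * RtoC (b - a) + l * RtoC ((b ^+ 2 - a ^+ 2) / 2).
Proof.
move=> ab; rewrite cintD; last exact/path_contZ/path_cont_id.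
  by rewrite cint_cst// cintZ ?cint_id//; exact: path_cont_id.
exact: path_cont_cst.
Qed.

End ComplexIntegral.

(** * Goursat's theorem for rectangles *)

Section Goursat.
Variable R : realType.
Local Notation C := R[i].
Local Notation Re := (@complex.Re R).
Local Notation Im := (@complex.Im R).
Implicit Types (f g : C -> C) (x y w h a b c : R) (k l z D : C).

(** The difference quotient multiplied out, so that [u = z] needs no exception. *)
Definition cderiv f z D := forall e, 0 < e -> exists2 del, 0 < del &
  forall u, cmod (u - z) < del -> cmod (f u - f z - D * (u - z)) <= e * cmod (u - z).

Definition cdiff f := forall z, exists D, cderiv f z D.

Definition ccont f := forall z e, 0 < e -> exists2 del, 0 < del &
  forall u, cmod (u - z) < del -> cmod (f u - f z) < e.

Lemma cdiff_cont f : cdiff f -> ccont f.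
Proof.
move=> df z e e0; have [D HD] := df z; have [d1 d10 H] := HD 1 ltr01.
have k0 : 0 < 1 + cmod D by rewrite ltr_wpDr// cmod_ge0.
exists (Num.min d1 (e / (1 + cmod D))); first by rewrite lt_min d10 divr_gt0.
move=> u; rewrite lt_min ltr_pdivlMr// => /andP[/H h1 h2].
rewrite -(subrK (D * (u - z)) (f u - f z)) (le_lt_trans (cmodD _ _))// cmodM.
move: h1 h2; nra.
Qed.

Lemma cdiffD f g : cdiff f -> cdiff g -> cdiff (fun z => f z + g z).
Proof.
move=> df dg z; have [D HD] := df z; have [E HE] := dg z.
exists (D + E) => e e0; have e2 : 0 < e / 2 by lra.
have [d1 d10 h1] := HD _ e2; have [d2 d20 h2] := HE _ e2.
exists (Num.min d1 d2); first by rewrite lt_min d10.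
move=> u; rewrite lt_min => /andP[/h1 H1 /h2 H2].
have -> : f u + g u - (f z + g z) - (D + E) * (u - z) =
  (f u - f z - D * (u - z)) + (g u - g z - E * (u - z)) by ring.
rewrite (le_trans (cmodD _ _))//; move: H1 H2; lra.
Qed.

Lemma cdiffZ k f : cdiff f -> cdiff (fun z => k * f z).
Proof.
move=> df z; have [D HD] := df z; exists (k * D) => e e0.
have k0 : 0 < 1 + cmod k by rewrite ltr_wpDr// cmod_ge0.
have [d1 d10 h1] := HD _ (divr_gt0 e0 k0).
exists d1 => // u /h1 H1.
have -> : k * f u - k * f z - k * D * (u - z) = k * (f u - f z - D * (u - z)).
  by ring.
rewrite cmodM -(ler_pM2l k0) mulrA; apply: le_trans (_ : _ <=
   (1 + cmod k) * ((1 + cmod k) * (e / (1 + cmod k) * cmod (u - z)))) _.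
  rewrite -mulrA ler_wpM2l ?(ltW k0)//.
  apply: ler_pM => //; [exact: cmod_ge0|exact: cmod_ge0|lra].
by rewrite le_eqVlt; apply/orP; left; apply/eqP; field; rewrite gt_eqF.
Qed.

Lemma Complex_sub x y a b : cmod (Complex x y - Complex a b) <= `|x - a| + `|y - b|.
Proof. exact: cmod_le. Qed.

Lemma hpath_cont f y : ccont f -> path_cont (fun t => f (Complex t y)).
Proof.
move=> cf t e e0; have [del d0 H] := cf (Complex t y) e e0.
exists del => // s st; apply: H; rewrite (le_lt_trans (Complex_sub _ _ _ _))//.
by rewrite subrr normr0 addr0.
Qed.

Lemma vpath_cont f x : ccont f -> path_cont (fun s => f (Complex x s)).
Proof.
move=> cf t e e0; have [del d0 H] := cf (Complex x t) e e0.
exists del => // s st; apply: H; rewrite (le_lt_trans (Complex_sub _ _ _ _))//.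
by rewrite subrr normr0 add0r.
Qed.

(* The contour integral over the boundary of [x, x + w] x [y, y + h]. *)
Definition rectint f x y w h : C :=
  cint (fun t => f (Complex t y)) x (x + w)
  + 'i * cint (fun s => f (Complex (x + w) s)) y (y + h)
  - cint (fun t => f (Complex t (y + h))) x (x + w)
  - 'i * cint (fun s => f (Complex x s)) y (y + h).

(** Each inner edge is traversed twice, in opposite directions, and cancels. *)
Lemma rectint_split f x y w1 w2 h1 h2 : ccont f ->
  0 <= w1 -> 0 <= w2 -> 0 <= h1 -> 0 <= h2 ->
  rectint f x y (w1 + w2) (h1 + h2) =
  rectint f x y w1 h1 + rectint f (x + w1) y w2 h1
  + rectint f x (y + h1) w1 h2 + rectint f (x + w1) (y + h1) w2 h2.
Proof.
move=> cf w10 w20 h10 h20.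
have H v : cint (fun t => f (Complex t v)) x (x + (w1 + w2)) =
    cint (fun t => f (Complex t v)) x (x + w1) +
    cint (fun t => f (Complex t v)) (x + w1) (x + w1 + w2).
  by rewrite (@cint_chasles _ _ x (x + w1)) ?addrA//; [exact: hpath_cont|lra|lra].
have V v : cint (fun t => f (Complex v t)) y (y + (h1 + h2)) =
    cint (fun t => f (Complex v t)) y (y + h1) +
    cint (fun t => f (Complex v t)) (y + h1) (y + h1 + h2).
  by rewrite (@cint_chasles _ _ y (y + h1)) ?addrA//; [exact: vpath_cont|lra|lra].
by rewrite /rectint !H !V !addrA; ring.
Qed.

(** This lets Goursat's argument subtract the first-order part of [f] at a point without changing
    the contour integral. *)
Lemma rectint_affine k l x y w h : 0 <= w -> 0 <= h ->
  rectint (fun z => k + l * z) x y w h = 0.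
Proof.
move=> w0 h0; rewrite /rectint.
have H v : cint (fun t => k + l * Complex t v) x (x + w) =
   (k + l * Complex 0 v) * RtoC (x + w - x) + l * RtoC (((x + w) ^+ 2 - x ^+ 2) / 2).
  rewrite -cint_affine; last by lra.
  apply: eq_cint => t _; rewrite -addrA -mulrDr; congr (k + l * _).
  by apply/eqP; rewrite eq_complex /= add0r addr0 !eqxx.
have V v : cint (fun t => k + l * Complex v t) y (y + h) =
   (k + l * Complex v 0) * RtoC (y + h - y) +
   l * 'i * RtoC (((y + h) ^+ 2 - y ^+ 2) / 2).
  rewrite -cint_affine; last by lra.
  apply: eq_cint => t _; rewrite -addrA -mulrA -mulrDr; congr (k + l * _).
  by apply/eqP; rewrite iE eq_complex /=; apply/andP; split; apply/eqP; ring.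
rewrite !H !V iE; case: k {H V} => k1 k2; case: l => l1 l2.
by apply/eqP; rewrite eq_complex /=; apply/andP; split; apply/eqP; field.
Qed.

Lemma rectintD f g x y w h : ccont f -> ccont g ->
  rectint (fun z => f z + g z) x y w h = rectint f x y w h + rectint g x y w h.
Proof.
move=> cf cg; rewrite /rectint !cintD; try exact: hpath_cont; try exact: vpath_cont.
by ring.
Qed.

(** The perimeter is [2 * (w + h)], and [cint_le] contributes another factor 2. *)
Lemma rectint_le f x y w h m : ccont f -> 0 <= w -> 0 <= h ->
  (forall t s, x <= t <= x + w -> y <= s <= y + h -> cmod (f (Complex t s)) <= m) ->
  cmod (rectint f x y w h) <= 4 * m * (w + h).
Proof.
move=> cf w0 h0 H.
have Hh v : y <= v <= y + h ->
    cmod (cint (fun t => f (Complex t v)) x (x + w)) <= 2 * m * w.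
  move=> yv; have -> : 2 * m * w = 2 * m * (x + w - x) by ring.
  apply: cint_le; [exact: hpath_cont|lra|].
  by move=> t xt; exact: H.
have Hv v : x <= v <= x + w ->
    cmod ('i * cint (fun s => f (Complex v s)) y (y + h)) <= 2 * m * h.
  move=> yv; rewrite cmodM cmodi mul1r.
  have -> : 2 * m * h = 2 * m * (y + h - y) by ring.
  apply: cint_le; [exact: vpath_cont|lra|].
  by move=> t xt; exact: H.
have h1 := Hh y; have h2 := Hh (y + h); have h3 := Hv x; have h4 := Hv (x + w).
rewrite /rectint (le_trans (cmodB _ _))//.
have := cmodB (cint (fun t => f (Complex t y)) x (x + w) +
  'i * cint (fun s => f (Complex (x + w) s)) y (y + h))
  (cint (fun t => f (Complex t (y + h))) x (x + w)).
have := cmodD (cint (fun t => f (Complex t y)) x (x + w))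
  ('i * cint (fun s => f (Complex (x + w) s)) y (y + h)).
have {}h1 := h1 _; have {}h2 := h2 _.
move: (h1 ltac:(lra)) (h2 ltac:(lra)) (h3 ltac:(lra)) (h4 ltac:(lra)); lra.
Qed.

Lemma half_small c del : 0 < del -> exists n, c / 2 ^+ n < del.
Proof.
move=> d0; exists (Num.bound (c / del)).
have p0 : (0 : R) < 2 ^+ Num.bound (c / del) by rewrite exprn_gt0.
rewrite ltr_pdivrMr// mulrC -ltr_pdivrMr//.
exact: upper_nthrootP.
Qed.

(** Left end points increase and right end points decrease, so the supremum of the left ones lies in
    every interval. *)
Lemma nested_point (xs : nat -> R) w : 0 <= w ->
  (forall n, xs n <= xs n.+1 <= xs n + w / 2 ^+ n.+1) ->
  exists c, forall n, xs n <= c <= xs n + w / 2 ^+ n.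
Proof.
move=> w0 H.
have hw n : w / 2 ^+ n = w / 2 ^+ n.+1 + w / 2 ^+ n.+1.
  by rewrite exprS; field; rewrite expf_neq0// pnatr_eq0.
have up n (k : nat) : xs n <= xs (n + k)%N.
  elim: k => [|k IH]; first by rewrite addn0.
  by rewrite addnS; have := H (n + k)%N; lra.
have dn n (k : nat) : xs (n + k)%N + w / 2 ^+ (n + k) <= xs n + w / 2 ^+ n.
  elim: k => [|k IH]; first by rewrite addn0.
  by rewrite addnS; have := H (n + k)%N; have := hw (n + k)%N; lra.
have pos n : 0 <= w / 2 ^+ n by rewrite divr_ge0// exprn_ge0.
have ub n m : xs m <= xs n + w / 2 ^+ n.
  case: (leqP n m) => nm.
    by rewrite -(subnKC nm); have := dn n (m - n)%N; have := pos (n + (m - n))%N; lra.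
  have := up m (n - m)%N; rewrite (subnKC (ltnW nm)); have := pos n; lra.
have hs : has_sup (range xs).
  split; first by exists (xs 0%N); exists 0%N.
  by exists (xs 0%N + w / 2 ^+ 0) => _ [m _ <-]; exact: ub.
exists (sup (range xs)) => n; apply/andP; split.
  by apply: ub_le_sup; [case: hs|exists n].
by apply: ge_sup; [case: hs|move=> _ [m _ <-]; exact: ub].
Qed.

Lemma rectint_quarter f x y w h m : ccont f -> 0 <= w -> 0 <= h ->
  m <= cmod (rectint f x y w h) ->
  exists p : R * R, [/\ x <= p.1 <= x + w / 2, y <= p.2 <= y + h / 2 &
    m / 4 <= cmod (rectint f p.1 p.2 (w / 2) (h / 2))].
Proof.
move=> cf w0 h0; have w2 : 0 <= w / 2 by lra. have h2 : 0 <= h / 2 by lra.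
have {1}-> : w = w / 2 + w / 2 by field.
have {1}-> : h = h / 2 + h / 2 by field.
rewrite rectint_split//.
set J1 := rectint f x y _ _; set J2 := rectint f (x + _) y _ _.
set J3 := rectint f x (y + _) _ _; set J4 := rectint f (x + _) (y + _) _ _ => mJ.
case: (leP (m / 4) (cmod J1)) => [?|j1]; first by exists (x, y); split=> //=; lra.
case: (leP (m / 4) (cmod J2)) => [?|j2]; first by exists (x + w / 2, y); split=> //=; lra.
case: (leP (m / 4) (cmod J3)) => [?|j3]; first by exists (x, y + h / 2); split=> //=; lra.
case: (leP (m / 4) (cmod J4)) => [?|j4].
  by exists (x + w / 2, y + h / 2); split=> //=; lra.
have := cmodD (J1 + J2 + J3) J4; have := cmodD (J1 + J2) J3; have := cmodD J1 J2.
lra.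
Qed.

Theorem goursat f x y w h : cdiff f -> 0 <= w -> 0 <= h ->
  rectint f x y w h = 0.
Proof.
move=> df w0 h0; have cf := cdiff_cont df.
set J := cmod (rectint f x y w h).
(* By [rectint_quarter], some quarter of a bad rectangle keeps a quarter of the lower bound, so bad
   rectangles shrink to a point. *)
pose bad n (p : R * R) :=
  J / 4 ^+ n <= cmod (rectint f p.1 p.2 (w / 2 ^+ n) (h / 2 ^+ n)).
have half c n : c / 2 ^+ n / 2 = c / 2 ^+ n.+1.
  by rewrite exprS; field; rewrite expf_neq0// pnatr_eq0.
(* A total function of [p], with an irrelevant value when [p] is not bad, so that [ps] can be
   defined by plain recursion. *)
have step n (p : R * R) : {q : R * R | bad n p ->
    [/\ p.1 <= q.1 <= p.1 + w / 2 ^+ n.+1, p.2 <= q.2 <= p.2 + h / 2 ^+ n.+1 &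
     bad n.+1 q]}.
  apply: cid; have [b|nb] := pselect (bad n p); last by exists p.
  have [||q [q1 q2 q3]] := rectint_quarter cf _ _ b.
  - by rewrite divr_ge0// exprn_ge0.
  - by rewrite divr_ge0// exprn_ge0.
  exists q => _; rewrite -!half; split => //; rewrite /bad -!half.
  by move: q3; rewrite exprS invfM mulrA mulrAC.
pose fix ps n : R * R := if n is m.+1 then sval (step m (ps m)) else (x, y).
have badp n : bad n (ps n).
  elim: n => [|n IH]; first by rewrite /bad /= !expr0 !divr1.
  by have [_ _] := svalP (step n (ps n)) IH.
have [X HX] : exists c, forall n, (ps n).1 <= c <= (ps n).1 + w / 2 ^+ n.
  apply: nested_point => // n.
  by have [] := svalP (step n (ps n)) (badp n).
have [Y HY] : exists c, forall n, (ps n).2 <= c <= (ps n).2 + h / 2 ^+ n.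
  apply: nested_point => // n.
  by have [] := svalP (step n (ps n)) (badp n).
have [D HD] := df (Complex X Y).
have key e : 0 < e -> J <= 4 * e * (w + h) ^+ 2.
  move=> e0; have [del d0 Hd] := HD e e0.
  have [n Hn] := half_small (w + h) d0.
  set wn := w / 2 ^+ n; set hn := h / 2 ^+ n.
  have wn0 : 0 <= wn by rewrite divr_ge0// exprn_ge0.
  have hn0 : 0 <= hn by rewrite divr_ge0// exprn_ge0.
  (* [r] is [f] minus its first-order part at the limit point: its contour integral is the same, but
     [r] is bounded by [e] times the distance to that point. *)
  pose k := f (Complex X Y) - D * Complex X Y.
  pose r z := f z + (- k + (- D) * z).
  have ca : ccont (fun z => - k + (- D) * z).
    apply: cdiff_cont => z; exists (- D) => eps eps0; exists 1 => // u _.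
    rewrite [X in cmod X](_ : _ = 0) ?cmod0 ?mulr_ge0 ?cmod_ge0 ?(ltW eps0)//.
    by ring.
  have Jr : rectint f (ps n).1 (ps n).2 wn hn = rectint r (ps n).1 (ps n).2 wn hn.
    by rewrite rectintD// rectint_affine// addr0.
  have Jb : cmod (rectint r (ps n).1 (ps n).2 wn hn) <=
      4 * (e * (wn + hn)) * (wn + hn).
    apply: rectint_le => //.
      move=> z eps eps0; have eps2 : 0 < eps / 2 by lra.
      have [d1 d10 h1] := cf z _ eps2; have [d2 d20 h2] := ca z _ eps2.
      exists (Num.min d1 d2); first by rewrite lt_min d10.
      move=> u; rewrite lt_min => /andP[/h1 H1 /h2 H2].
      have -> : r u - r z = (f u - f z) + ((- k + - D * u) - (- k + - D * z)).
        by rewrite /r; ring.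
      by rewrite (le_lt_trans (cmodD _ _))//; lra.
    move=> t s tX sY.
    have dd : cmod (Complex t s - Complex X Y) <= wn + hn.
      apply: (le_trans (Complex_sub _ _ _ _)); apply: lerD; rewrite ler_norml.
        by have := HX n; rewrite -/wn; lra.
      by have := HY n; rewrite -/hn; lra.
    have -> : r (Complex t s) = f (Complex t s) - f (Complex X Y) -
       D * (Complex t s - Complex X Y) by rewrite /r /k; ring.
    apply: (le_trans (Hd _ _)).
      by rewrite (le_lt_trans dd)// /wn /hn -mulrDl.
    by rewrite ler_wpM2l// ltW.
  have := badp n; rewrite /bad -/wn -/hn Jr => /le_trans /(_ Jb).
  (* The upper bound scales like [4 ^- n], exactly as the lower bound in [bad], so [n] drops out. *)
  have -> : 4 * (e * (wn + hn)) * (wn + hn) = 4 * e * (w + h) ^+ 2 / 4 ^+ n.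
    rewrite /wn /hn -mulrDl (_ : (4 : R) = 2 * 2) ?exprMn; last by ring.
    by field; rewrite expf_neq0// pnatr_eq0.
  by rewrite ler_pM2r// invr_gt0 exprn_gt0.
apply: cmod_eq0P; apply: small_eq0 => [|e e0]; first exact: cmod_ge0.
have q0 : 0 < 4 * (w + h) ^+ 2 + 1 by have := sqr_ge0 (w + h); lra.
apply: le_trans (key _ (divr_gt0 e0 q0)) _.
have -> : 4 * (e / (4 * (w + h) ^+ 2 + 1)) * (w + h) ^+ 2 =
    e * (4 * (w + h) ^+ 2 / (4 * (w + h) ^+ 2 + 1)) by field; rewrite gt_eqF.
rewrite -[leRHS]mulr1 ler_wpM2l ?(ltW e0)// ler_pdivrMr//; lra.
Qed.

End Goursat.

(** * Second-order expansions of the integral of [f] over a horizontal segment *)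

Section Smoothing.
Variable R : realType.
Local Notation C := R[i].
Local Notation Re := (@complex.Re R).
Local Notation Im := (@complex.Im R).
Implicit Types (f g F : C -> C) (x y w h a b c : R) (k l z D : C).

Lemma RtoC_half a : RtoC (a / 2) = RtoC a / 2.
Proof. by rewrite RtoCM RtoCV [in LHS]mulr2n RtoCD RtoC1. Qed.

(** A first-order expansion of [g] at [t0], integrated over a short interval containing [t0]: the
    error becomes of second order in the length. *)
Lemma cint_expansion (g : R -> C) t0 (D : C) e del a b : path_cont g -> 0 <= e ->
  (forall s, `|s - t0| < del -> cmod (g s - g t0 - D * RtoC (s - t0)) <= e * `|s - t0|) ->
  a <= t0 -> t0 <= b -> b - a < del ->
  cmod (cint g a b - ((g t0 - D * RtoC t0) * RtoC (b - a)
                      + D * RtoC ((b ^+ 2 - a ^+ 2) / 2))) <= 2 * e * (b - a) ^+ 2.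
Proof.
move=> cg e0 H at0 t0b bad.
have ca : path_cont (fun t => (- (g t0 - D * RtoC t0)) + (- D) * RtoC t).
  apply: path_contD; first exact: path_cont_cst.
  by apply: path_contZ; exact: path_cont_id.
have -> : cint g a b - ((g t0 - D * RtoC t0) * RtoC (b - a)
     + D * RtoC ((b ^+ 2 - a ^+ 2) / 2)) =
    cint (fun t => g t + ((- (g t0 - D * RtoC t0)) + (- D) * RtoC t)) a b.
  by rewrite cintD// cint_affine; [ring|lra].
have -> : 2 * e * (b - a) ^+ 2 = 2 * (e * (b - a)) * (b - a) by ring.
apply: cint_le; [exact: path_contD|lra|] => s sab.
have -> : g s + (- (g t0 - D * RtoC t0) + - D * RtoC s) =
   g s - g t0 - D * RtoC (s - t0) by rewrite RtoCB; ring.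
have st : `|s - t0| <= b - a by rewrite ler_norml; lra.
apply: (le_trans (H s _)); first by lra.
by rewrite ler_wpM2l.
Qed.

Lemma cderiv_h f x y D e del :
  (forall u, cmod (u - Complex x y) < del ->
     cmod (f u - f (Complex x y) - D * (u - Complex x y)) <= e * cmod (u - Complex x y)) ->
  forall s, `|s - x| < del ->
   cmod (f (Complex s y) - f (Complex x y) - D * RtoC (s - x)) <= e * `|s - x|.
Proof.
move=> H s; rewrite -cmodR.
have <- : Complex s y - Complex x y = RtoC (s - x).
  by apply/eqP; rewrite eq_complex /= subrr !eqxx.
exact: H.
Qed.

Lemma cderiv_v f x y D e del :
  (forall u, cmod (u - Complex x y) < del ->
     cmod (f u - f (Complex x y) - D * (u - Complex x y)) <= e * cmod (u - Complex x y)) ->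
  forall s, `|s - y| < del ->
   cmod (f (Complex x s) - f (Complex x y) - D * 'i * RtoC (s - y)) <= e * `|s - y|.
Proof.
move=> H s sy.
have E : Complex x s - Complex x y = 'i * RtoC (s - y).
  by apply/eqP; rewrite iE eq_complex /=; apply/andP; split; apply/eqP; ring.
have E2 : cmod (Complex x s - Complex x y) = `|s - y|.
  by rewrite E cmodM cmodi mul1r cmodR.
by rewrite -mulrA -E -E2; apply: H; rewrite E2.
Qed.

(** This is the function F of the overview: the integral of [f] along the segment from [z] to
    [z + w]. *)
Definition smooth f w z : C :=
  cint (fun t => f (Complex t (Im z))) (Re z) (Re z + w).

(** The integral over [[a, b + w]] is cut once at [b] and once at [a + w]. *)
Lemma smooth_h f w a b y : ccont f -> 0 <= w -> a <= b ->
  smooth f w (Complex b y) - smooth f w (Complex a y) =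
  cint (fun t => f (Complex t y)) (a + w) (b + w) - cint (fun t => f (Complex t y)) a b.
Proof.
move=> cf w0 ab; rewrite /smooth /=; have cg := hpath_cont y cf.
have h1 : cint (fun t => f (Complex t y)) a (b + w) =
   cint (fun t => f (Complex t y)) a b + cint (fun t => f (Complex t y)) b (b + w).
  by apply: cint_chasles => //; lra.
have h2 : cint (fun t => f (Complex t y)) a (b + w) =
   cint (fun t => f (Complex t y)) a (a + w)
   + cint (fun t => f (Complex t y)) (a + w) (b + w).
  by apply: cint_chasles => //; lra.
by move: h1; rewrite h2 => h1; apply/eqP; rewrite subr_eq addrAC eq_sym subr_eq addrC h1 addrC.
Qed.

(** Goursat's theorem on [[x, x + w]] x [[a, b]] trades the two horizontal sides for the two
    vertical ones. Both increments of [smooth f w] thus become integrals over short intervals near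
    [z] and near [z + w]. *)
Lemma smooth_v f w a b x : cdiff f -> 0 <= w -> a <= b ->
  smooth f w (Complex x b) - smooth f w (Complex x a) =
  'i * (cint (fun s => f (Complex (x + w) s)) a b - cint (fun s => f (Complex x s)) a b).
Proof.
move=> df w0 ab; rewrite /smooth /=.
have ba0 : 0 <= b - a by lra.
have := goursat x a df w0 ba0; rewrite /rectint addrC [a + _]addrC subrK => H.
apply/eqP; rewrite -subr_eq0 -[X in _ == X]oppr0 -{}H; apply/eqP; ring.
Qed.

Lemma smooth_cont f w : cdiff f -> 0 <= w -> ccont (smooth f w).
Proof.
move=> df w0; have cf := cdiff_cont df => -[x y] e e0.
have [d1 d10 H1] := cf (Complex x y) _ ltr01.
have [d2 d20 H2] := cf (Complex (x + w) y) _ ltr01.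
(* The increments only see [f] near the two end points of the segment, so a bound at these two
   places makes [smooth f w] Lipschitz with constant [4 * M] along each axis. *)
pose M := cmod (f (Complex x y)) + cmod (f (Complex (x + w) y)) + 1.
have M0 : 0 < M by rewrite /M ltr_wpDl// addr_ge0// cmod_ge0.
have B1 t s : `|t - x| + `|s - y| < d1 -> cmod (f (Complex t s)) <= M.
  move=> ts; rewrite -(subrK (f (Complex x y)) (f (Complex t s))).
  have h := H1 _ (le_lt_trans (Complex_sub t s x y) ts).
  rewrite (le_trans (cmodD _ _))// /M; have := cmod_ge0 (f (Complex (x + w) y)); lra.
have B2 t s : `|t - (x + w)| + `|s - y| < d2 -> cmod (f (Complex t s)) <= M.
  move=> ts; rewrite -(subrK (f (Complex (x + w) y)) (f (Complex t s))).
  have h := H2 _ (le_lt_trans (Complex_sub t s (x + w) y) ts).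
  rewrite (le_trans (cmodD _ _))// /M; have := cmod_ge0 (f (Complex x y)); lra.
(* The halves leave room for adding a horizontal and a vertical displacement; [e / (8 * M)] makes
   each of the two increments less than [e / 2]. *)
pose del := Num.min (Num.min (d1 / 2) (d2 / 2)) (e / (8 * M)).
have del0 : 0 < del by rewrite !lt_min !divr_gt0// mulr_gt0.
exists del => // -[x' y'] Hz.
have xx : `|x' - x| < del := le_lt_trans (cmod_Re (Complex x' y' - Complex x y)) Hz.
have yy : `|y' - y| < del := le_lt_trans (cmod_Im (Complex x' y' - Complex x y)) Hz.
have hstep a b : a <= b -> `|a - x| < del -> `|b - x| < del ->
    cmod (smooth f w (Complex b y) - smooth f w (Complex a y)) <= 4 * M * (b - a).
  rewrite /del !lt_min => ab /andP[/andP[a1 a2] _] /andP[/andP[b1 b2] _].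
  rewrite smooth_h//; apply: (le_trans (cmodB _ _)).
  have -> : 4 * M * (b - a) = 2 * M * (b + w - (a + w)) + 2 * M * (b - a) by ring.
  move: a1 a2 b1 b2; rewrite !ltr_norml => a1 a2 b1 b2.
  apply: lerD; apply: cint_le; try exact: hpath_cont; try lra.
    move=> t ht; apply: B2; rewrite subrr normr0 addr0 ltr_norml.
    by apply/andP; split; lra.
  move=> t ht; apply: B1; rewrite subrr normr0 addr0 ltr_norml.
  by apply/andP; split; lra.
have vstep a b : a <= b -> `|a - y| < del -> `|b - y| < del ->
    cmod (smooth f w (Complex x' b) - smooth f w (Complex x' a)) <= 4 * M * (b - a).
  move: (xx); rewrite /del !lt_min => /andP[/andP[x1 x2] _].
  move=> ab /andP[/andP[a1 a2] _] /andP[/andP[b1 b2] _].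
  rewrite smooth_v// cmodM cmodi mul1r; apply: (le_trans (cmodB _ _)).
  have -> : 4 * M * (b - a) = 2 * M * (b - a) + 2 * M * (b - a) by ring.
  move: a1 a2 b1 b2; rewrite !ltr_norml => a1 a2 b1 b2.
  apply: lerD; apply: cint_le => //; try exact: vpath_cont.
    move=> t ht; apply: B2; have -> : x' + w - (x + w) = x' - x by ring.
    have : `|t - y| <= d2 / 2 by rewrite ler_norml; apply/andP; split; lra.
    by lra.
  move=> t ht; apply: B1.
  have : `|t - y| <= d1 / 2 by rewrite ler_norml; apply/andP; split; lra.
  by lra.
have hs : cmod (smooth f w (Complex x' y) - smooth f w (Complex x y)) <= 4 * M * `|x' - x|.
  have x0 : `|x - x| < del by rewrite subrr normr0.
  case: (leP x x') => xx'.
    by rewrite (ger0_norm (_ : 0 <= x' - x)) ?subr_ge0//; exact: hstep.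
  by rewrite cmodBC distrC (ger0_norm (_ : 0 <= x - x')) ?subr_ge0 ?(ltW xx')//;
    apply: hstep => //; exact: ltW.
have vs : cmod (smooth f w (Complex x' y') - smooth f w (Complex x' y)) <= 4 * M * `|y' - y|.
  have y0 : `|y - y| < del by rewrite subrr normr0.
  case: (leP y y') => yy'.
    by rewrite (ger0_norm (_ : 0 <= y' - y)) ?subr_ge0//; exact: vstep.
  by rewrite cmodBC distrC (ger0_norm (_ : 0 <= y - y')) ?subr_ge0 ?(ltW yy')//;
    apply: vstep => //; exact: ltW.
move: xx yy; rewrite !lt_min !ltr_pdivlMr ?mulr_gt0// => /andP[_ xx] /andP[_ yy].
rewrite -(subrK (smooth f w (Complex x' y)) (smooth f w (Complex x' y'))) -addrA.
apply: (le_lt_trans (cmodD _ _)); lra.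
Qed.

(* The maximum principle below only compares a point with its four neighbours, so the
   expansion is only needed along the axis directions. *)
Definition peano4 F z := exists A B : C, forall e : R, 0 < e -> exists2 del, 0 < del &
  forall k : R, 0 < k -> k < del -> forall u : C, u \in [:: 1; -1; 'i; - 'i] ->
   cmod (F (z + u * RtoC k) - F z - A * (u * RtoC k) - B * (u * RtoC k) ^+ 2) <= e * k ^+ 2.

Lemma smooth_peano4 f w z : cdiff f -> 0 <= w -> peano4 (smooth f w) z.
Proof.
move=> df w0; have cf := cdiff_cont df; case: z => x y.
have [D1 HD1] := df (Complex x y); have [D2 HD2] := df (Complex (x + w) y).
(* These are the first derivative of [smooth f w] at [z] and half of the second. *)
exists (f (Complex (x + w) y) - f (Complex x y)), ((D2 - D1) / 2) => e e0.
have e4 : 0 < e / 4 by lra.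
have [d1 d10 h1] := HD1 _ e4; have [d2 d20 h2] := HD2 _ e4.
have H1 := cderiv_h h1; have H2 := cderiv_h h2.
have V1 := cderiv_v h1; have V2 := cderiv_v h2.
exists (Num.min d1 d2); first by rewrite lt_min d10.
move=> k k0; rewrite lt_min => /andP[k1 k2].
have two0 : (2 : C) != 0 by rewrite pnatr_eq0.
(* [v] is the direction, [p] and [q] are the integrals near [z + w] and near [z], [p'] and [q']
   their expansions; the two errors add up to [e * k ^+ 2]. *)
have fin (v p q p' q' S : C) : cmod v = 1 -> S = v * (p - q - (p' - q')) ->
  cmod (p - p') <= 2 * (e / 4) * k ^+ 2 -> cmod (q - q') <= 2 * (e / 4) * k ^+ 2 ->
  cmod S <= e * k ^+ 2.
  move=> v1 ->; rewrite cmodM v1 mul1r.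
  have -> : p - q - (p' - q') = (p - p') - (q - q') by ring.
  by move=> ? ?; rewrite (le_trans (cmodB _ _))//; lra.
have hc := hpath_cont y cf.
have vc1 := vpath_cont x cf; have vc2 := vpath_cont (x + w) cf.
have H (a b t0 : R) (g : R -> C) (D : C) (del : R) : path_cont g -> b - a = k -> a <= t0 -> t0 <= b ->
  (forall s, `|s - t0| < del -> cmod (g s - g t0 - D * RtoC (s - t0)) <= e / 4 * `|s - t0|) ->
  k < del -> cmod (cint g a b - ((g t0 - D * RtoC t0) * RtoC k
                      + D * RtoC ((b ^+ 2 - a ^+ 2) / 2))) <= 2 * (e / 4) * k ^+ 2.
  by move=> cg <- at0 tb Hg kd; apply: (@cint_expansion _ _ _ _ del) => //; exact: ltW.
move=> u; rewrite !inE => /or4P[] /eqP ->.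
- have /= P2 := H (x + w) (x + w + k) (x + w) _ D2 d2 hc ltac:(ring) ltac:(lra) ltac:(lra) H2 k2.
  have /= P1 := H x (x + k) x _ D1 d1 hc ltac:(ring) ltac:(lra) ltac:(lra) H1 k1.
  apply: (fin 1 _ _ _ _ _ _ _ P2 P1); first by rewrite ?cmod1//.
  rewrite !mul1r; have -> : Complex x y + RtoC k = Complex (x + k) y.
    by apply/eqP; rewrite eq_complex /= addr0 !eqxx.
  rewrite smooth_h//; last by lra.
  rewrite [x + w + k]addrAC !RtoC_half !(RtoCD, RtoCN, RtoCX).
  by field.
- have /= P2 := H (x + w - k) (x + w) (x + w) _ D2 d2 hc ltac:(ring) ltac:(lra) ltac:(lra) H2 k2.
  have /= P1 := H (x - k) x x _ D1 d1 hc ltac:(ring) ltac:(lra) ltac:(lra) H1 k1.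
  apply: (fin (-1) _ _ _ _ _ _ _ P2 P1); first by rewrite ?cmodN ?cmod1//.
  rewrite !mulN1r; have -> : Complex x y - RtoC k = Complex (x - k) y.
    by apply/eqP; rewrite eq_complex /= oppr0 addr0 !eqxx.
  rewrite -[smooth _ _ _ - smooth _ _ _]opprB smooth_h//; last by lra.
  rewrite [x + w - k]addrAC !RtoC_half !(RtoCD, RtoCN, RtoCX).
  by field.
- have /= P2 := H y (y + k) y _ _ d2 vc2 ltac:(ring) ltac:(lra) ltac:(lra) V2 k2.
  have /= P1 := H y (y + k) y _ _ d1 vc1 ltac:(ring) ltac:(lra) ltac:(lra) V1 k1.
  apply: (fin 'i _ _ _ _ _ _ _ P2 P1); first by rewrite ?cmodi//.
  have -> : Complex x y + 'i * RtoC k = Complex x (y + k).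
    by rewrite iE; apply/eqP; rewrite eq_complex /=; apply/andP; split; apply/eqP; ring.
  rewrite smooth_v//; last by lra.
  rewrite !RtoC_half !(RtoCD, RtoCN, RtoCX).
  by field.
- have /= P2 := H (y - k) y y _ _ d2 vc2 ltac:(ring) ltac:(lra) ltac:(lra) V2 k2.
  have /= P1 := H (y - k) y y _ _ d1 vc1 ltac:(ring) ltac:(lra) ltac:(lra) V1 k1.
  apply: (fin (- 'i) _ _ _ _ _ _ _ P2 P1); first by rewrite ?cmodN ?cmodi//.
  have -> : Complex x y + - 'i * RtoC k = Complex x (y - k).
    by rewrite iE; apply/eqP; rewrite eq_complex /=; apply/andP; split; apply/eqP; ring.
  rewrite -[smooth _ _ _ - smooth _ _ _]opprB smooth_v//; last by lra.
  rewrite !RtoC_half !(RtoCD, RtoCN, RtoCX).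
  by field.
Qed.

End Smoothing.

(** * Entire functions vanishing on the real line *)

Section IdentityTheorem.
Variable R : realType.
Local Notation C := R[i].
Local Notation Re := (@complex.Re R).
Local Notation Im := (@complex.Im R).
Implicit Types (f g F : C -> C) (x y w h a b c : R) (z D : C).

Lemma cmod_unit4 (u : C) : u \in [:: 1; -1; 'i; - 'i] -> cmod u = 1.
Proof. by rewrite !inE => /or4P[] /eqP ->; rewrite ?cmodN ?cmod1 ?cmodi. Qed.

(** The new coefficients are those of the product of the two expansions, cut after degree 2. As [g]
    has an exact quadratic expansion, what is left over is terms in [h ^+ 3] and [h ^+ 4] and the
    remainder of [F] times [g]. *)
Lemma peano4_mul_quadratic F g z (p0 p1 p2 : C) : peano4 F z ->
  (forall h : C, g (z + h) = p0 + p1 * h + p2 * h ^+ 2) ->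
  peano4 (fun v => F v * g v) z.
Proof.
move=> [A [B HF]] Hg; have g0 : g z = p0 by have := Hg 0; rewrite addr0 => ->; ring.
exists (F z * p1 + A * p0), (F z * p2 + A * p1 + B * p0) => e e0.
(* For [k < 1], [P] bounds [g (z + h)], and [Q * k ^+ 3] bounds the terms of degree 3 and 4. *)
pose P := cmod p0 + cmod p1 + cmod p2.
pose Q := cmod (A * p2 + B * p1) + cmod (B * p2).
have P0 : 0 <= P by rewrite !addr_ge0 ?cmod_ge0.
have Q0 : 0 <= Q by rewrite addr_ge0 ?cmod_ge0.
have eP : 0 < e / 2 / (P + 1) by rewrite !divr_gt0//; lra.
have [d1 d10 H] := HF _ eP.
exists (Num.min (Num.min 1 d1) (e / 2 / (Q + 1))).
  by rewrite !lt_min ltr01 d10 !divr_gt0//; lra.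
move=> k k0; rewrite !lt_min => /andP[/andP[k1 kd] kQ] u hu.
have := H k k0 kd u hu; rewrite Hg.
set h := u * RtoC k; have hk : cmod h = k.
  by rewrite /h cmodM cmod_unit4// mul1r cmodRp// ltW.
set r := F (z + h) - F z - A * h - B * h ^+ 2 => Hr.
have -> : F (z + h) * (p0 + p1 * h + p2 * h ^+ 2) - F z * g z -
   (F z * p1 + A * p0) * h - (F z * p2 + A * p1 + B * p0) * h ^+ 2 =
   (A * p2 + B * p1) * h ^+ 3 + B * p2 * h ^+ 4 + r * (p0 + p1 * h + p2 * h ^+ 2).
  by rewrite g0 /r; ring.
have gP : cmod (p0 + p1 * h + p2 * h ^+ 2) <= P.
  apply: (le_trans (cmodD _ _)); apply: lerD.
    apply: (le_trans (cmodD _ _)); rewrite lerD2l cmodM hk.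
    by rewrite ler_piMr ?cmod_ge0// ltW.
  by rewrite cmodM cmodX hk ler_piMr ?cmod_ge0// expr_le1// ltW.
have t1 : cmod ((A * p2 + B * p1) * h ^+ 3 + B * p2 * h ^+ 4) <= Q * k * k ^+ 2.
  apply: (le_trans (cmodD _ _)); rewrite [cmod (_ * h ^+ 3)]cmodM [cmod (_ * h ^+ 4)]cmodM !cmodX hk /Q.
  have k4 : k ^+ 4 <= k * k ^+ 2.
    rewrite -exprS ler_wiXn2l//; lra.
  rewrite -mulrA mulrDl -exprS; apply: lerD => //.
  by rewrite exprS in k4 *; apply: ler_wpM2l => //; exact: cmod_ge0.
have t2 : cmod (r * (p0 + p1 * h + p2 * h ^+ 2)) <= e / 2 * k ^+ 2.
  rewrite cmodM; apply: (@le_trans _ _ (e / 2 / (P + 1) * k ^+ 2 * P)).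
    by apply: ler_pM => //; exact: cmod_ge0.
  rewrite mulrAC; apply: ler_wpM2r; first exact: sqr_ge0.
  have -> : e / 2 / (P + 1) * P = e / 2 * (P / (P + 1)) by ring.
  rewrite -[leRHS]mulr1; apply: ler_wpM2l; first by lra.
  by rewrite ler_pdivrMr; lra.
have t3 : Q * k * k ^+ 2 <= e / 2 * k ^+ 2.
  apply: ler_wpM2r; first exact: sqr_ge0.
  by move: kQ; rewrite ltr_pdivlMr; nra.
by apply: (le_trans (cmodD _ _)); lra.
Qed.

Lemma peano4_mul_quadraticX F g z (p0 p1 p2 : C) n : peano4 F z ->
  (forall h : C, g (z + h) = p0 + p1 * h + p2 * h ^+ 2) ->
  peano4 (fun v => F v * g v ^+ n) z.
Proof.
move=> HF Hg; elim: n => [|n IH].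
  have -> // : (fun v => F v * g v ^+ 0) = F by apply/funext => v; rewrite expr0 mulr1.
have -> : (fun v => F v * g v ^+ n.+1) = fun v => F v * g v ^+ n * g v.
  by apply/funext => v; rewrite exprSr mulrA.
exact: peano4_mul_quadratic IH Hg.
Qed.

Lemma ccontM f g : ccont f -> ccont g -> ccont (fun z => f z * g z).
Proof.
move=> cf cg z e e0.
pose M := cmod (f z) + cmod (g z) + 1.
have M0 : 0 < M by rewrite /M ltr_wpDl// addr_ge0// cmod_ge0.
have eM : 0 < Num.min 1 (e / (2 * M)) by rewrite lt_min ltr01 divr_gt0// mulr_gt0.
have [d1 d10 h1] := cf z _ eM; have [d2 d20 h2] := cg z _ eM.
exists (Num.min d1 d2); first by rewrite lt_min d10.
move=> u; rewrite lt_min => /andP[/h1 + /h2].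
rewrite !lt_min => /andP[H1 H1'] /andP[H2 H2'].
have -> : f u * g u - f z * g z = (f u - f z) * ((g u - g z) + g z) + f z * (g u - g z).
  by ring.
apply: (le_lt_trans (cmodD _ _)); rewrite !cmodM.
have K := cmodD (g u - g z) (g z).
move: H1' H2'; rewrite !ltr_pdivlMr ?mulr_gt0// => H1' H2'.
have a1 : cmod (f u - f z) * cmod (g u - g z + g z) <= cmod (f u - f z) * M.
  by apply: ler_wpM2l; [exact: cmod_ge0|rewrite /M; have := cmod_ge0 (f z); lra].
have a2 : cmod (f z) * cmod (g u - g z) <= M * cmod (g u - g z).
  by apply: ler_wpM2r; [exact: cmod_ge0|rewrite /M; have := cmod_ge0 (g z); lra].
lra.
Qed.

Lemma ccont_cst (k : C) : ccont (fun=> k).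
Proof. by move=> z e e0; exists 1 => // u _; rewrite subrr cmod0. Qed.

Lemma ccontX f n : ccont f -> ccont (fun z => f z ^+ n).
Proof.
move=> cf; elim: n => [|n IH]; first exact: ccont_cst.
have -> : (fun z => f z ^+ n.+1) = fun z => f z * f z ^+ n.
  by apply/funext => z; rewrite exprS.
exact: ccontM.
Qed.

Lemma ccont_cmod F : ccont F ->
  continuous (fun q : R * R => cmod (F (Complex q.1 q.2))).
Proof.
move=> cF q; apply/cvgrPdist_lt => e e0.
have [del d0 H] := cF (Complex q.1 q.2) e e0.
have d2 : 0 < del / 2 by lra.
near=> p; apply: (@le_lt_trans _ _ (cmod (F (Complex p.1 p.2) - F (Complex q.1 q.2)))).
  rewrite distrC ler_norml.
  have := cmodD (F (Complex p.1 p.2) - F (Complex q.1 q.2)) (F (Complex q.1 q.2)).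
  have := cmodD (F (Complex q.1 q.2) - F (Complex p.1 p.2)) (F (Complex p.1 p.2)).
  rewrite [cmod (F (Complex q.1 q.2) - _)]cmodBC !subrK; lra.
apply: H; apply: (le_lt_trans (Complex_sub _ _ _ _)).
have p1 : `|p.1 - q.1| < del / 2.
  rewrite distrC; near: p.
  have /cvgrPdist_lt : (fst : R * R -> R) p @[p --> q] --> q.1 by apply: cvg_fst.
  exact.
have p2 : `|p.2 - q.2| < del / 2.
  rewrite distrC; near: p.
  have /cvgrPdist_lt : (snd : R * R -> R) p @[p --> q] --> q.2 by apply: cvg_snd.
  exact.
lra.
Unshelve. all: by end_near.
Qed.

(* |H|^2 + |z|^2 attains its maximum over the rectangle, and not at an interior point: its sum
   over the four neighbours of a point exceeds four times its value there, because
   |H(z + h)|^2 >= |H(z)|^2 + 2 Re (conj (H z) (H(z + h) - H z)) and the expansion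
   terms of H cancel up to o(k^2). *)
Lemma weak_maximum F (L K M : R) : ccont F -> (forall z, peano4 F z) ->
  0 <= L -> 0 <= K ->
  (forall x y, `|x| <= L -> 0 <= y <= K ->
     [|| `|x| == L, y == 0 | y == K] -> cmod (F (Complex x y)) <= M) ->
  forall x y, `|x| <= L -> 0 <= y <= K ->
    cmod (F (Complex x y)) ^+ 2 <= M ^+ 2 + L ^+ 2 + K ^+ 2.
Proof.
move=> cF pF L0 K0 HM.
pose v (q : R * R) := cmod (F (Complex q.1 q.2)) ^+ 2 + (q.1 ^+ 2 + q.2 ^+ 2).
have cv : continuous v.
  move=> q; apply: cvgD; first by apply: cvgM; exact: (ccont_cmod cF).
  apply: cvgD.
    by apply: (@cvgM _ _ _ _ fst fst); exact: cvg_fst.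
  by apply: (@cvgM _ _ _ _ snd snd); exact: cvg_snd.
pose A : set (R * R) := `[- L, L]%classic `*` `[0, K]%classic.
have AE q : A q <-> `|q.1| <= L /\ 0 <= q.2 <= K.
  by rewrite /A /= /setX /= !in_itv /= ler_norml.
have [|||c] := @compact_EVT_max _ R v A.
- by exists (0, 0); apply/AE => /=; rewrite normr0 lexx.
- by apply: compact_setX; exact: segment_compact.
- exact: continuous_subspaceT.
move=> /set_mem /AE [c1 c2] cmax.
have Hc : v c <= M ^+ 2 + (L ^+ 2 + K ^+ 2).
  have [bc|] := boolP [|| `|c.1| == L, c.2 == 0 | c.2 == K].
    have := HM _ _ c1 c2 bc; case/andP: c2 => c20 c2K Hm.
    rewrite /v; apply: lerD; first by rewrite lerXn2r// ?nnegrE ?(le_trans _ Hm) ?cmod_ge0.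
    apply: lerD; last by rewrite lerXn2r// ?nnegrE.
    by rewrite -real_normK ?num_real// lerXn2r// ?nnegrE.
  rewrite !negb_or => /and3P[b1 b2 b3]; exfalso.
  have {b1}c1L : `|c.1| < L by rewrite lt_neqAle b1.
  have [c20 c2K] : 0 < c.2 /\ c.2 < K.
    by case/andP: c2 => ? ?; rewrite !lt_neqAle b3 eq_sym b2.
  pose Z := Complex c.1 c.2; pose F0 := F Z.
  have [A' [B' HF]] := pF Z.
  have f00 := cmod_ge0 F0.
  (* With this tolerance the four remainders, weighted by [cmod F0], total at most [k ^+ 2]. They
     enter with a factor 2, which is less than the [4 * k ^+ 2] gained from |z|^2. *)
  have e0 : 0 < (4 * (cmod F0 + 1))^-1 by rewrite invr_gt0; lra.
  have [del d0 Hd] := HF _ e0.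
  pose m := Num.min (Num.min del (L - `|c.1|)) (Num.min c.2 (K - c.2)).
  have m0 : 0 < m by rewrite !lt_min d0 c20 !subr_gt0 c1L c2K.
  have [k k0 km] : exists2 k, 0 < k & k < m by exists (m / 2); lra.
  move: km; rewrite !lt_min => /andP[/andP[kd kL] /andP[kc kK]].
  have Hu (u : C) (q : R * R) : u \in [:: 1; -1; 'i; - 'i] ->
      Complex q.1 q.2 = Z + u * RtoC k ->
      exists2 r : C, cmod r <= (4 * (cmod F0 + 1))^-1 * k ^+ 2 &
      F (Complex q.1 q.2) = F0 + (A' * (u * RtoC k) + B' * (u * RtoC k) ^+ 2 + r).
    move=> hu ->; exists (F (Z + u * RtoC k) - F Z - A' * (u * RtoC k) - B' * (u * RtoC k) ^+ 2).
      exact: Hd.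
    by rewrite /F0; ring.
  have dotle (a d : C) :
     cmod a ^+ 2 + 2 * Re (a^* * d) <= cmod (a + d) ^+ 2.
    rewrite !cmod_sqr conjE; case: a => a1 a2; case: d => d1 d2 /=.
    have := sqr_ge0 d1; have := sqr_ge0 d2; nra.
  have [r1 R1 E1] := Hu 1 (c.1 + k, c.2) ltac:(by rewrite !inE eqxx)
    ltac:(by rewrite mul1r; apply/eqP; rewrite eq_complex /= addr0 !eqxx).
  have [r2 R2 E2] := Hu (-1) (c.1 - k, c.2) ltac:(by rewrite !inE eqxx ?orbT)
    ltac:(by rewrite mulN1r; apply/eqP; rewrite eq_complex /= oppr0 addr0 !eqxx).
  have [r3 R3 E3] := Hu 'i (c.1, c.2 + k) ltac:(by rewrite !inE eqxx ?orbT)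
    ltac:(by rewrite iE; apply/eqP; rewrite eq_complex /=; apply/andP; split; apply/eqP; ring).
  have [r4 R4 E4] := Hu (- 'i) (c.1, c.2 - k) ltac:(by rewrite !inE eqxx ?orbT)
    ltac:(by rewrite iE; apply/eqP; rewrite eq_complex /=; apply/andP; split; apply/eqP; ring).
  have nk : `|k| = k by rewrite ger0_norm// ltW.
  have M1 : v (c.1 + k, c.2) <= v c.
    apply: cmax; apply/mem_set/AE => /=; split=> //.
    by apply: (le_trans (ler_normD _ _)); rewrite nk; lra.
  have M2 : v (c.1 - k, c.2) <= v c.
    apply: cmax; apply/mem_set/AE => /=; split=> //.
    by apply: (le_trans (ler_normB _ _)); rewrite nk; lra.
  have M3 : v (c.1, c.2 + k) <= v c.
    by apply: cmax; apply/mem_set/AE => /=; split=> //; lra.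
  have M4 : v (c.1, c.2 - k) <= v c.
    by apply: cmax; apply/mem_set/AE => /=; split=> //; lra.
  move: M1 M2 M3 M4; rewrite /v E1 E2 E3 E4 -/Z -/F0 /= => M1 M2 M3 M4.
  set T1 := (X in F0 + X) in M1; set T2 := (X in F0 + X) in M2.
  set T3 := (X in F0 + X) in M3; set T4 := (X in F0 + X) in M4.
  have D1 := dotle F0 T1; have D2 := dotle F0 T2.
  have D3 := dotle F0 T3; have D4 := dotle F0 T4.
  (* The linear terms cancel between opposite neighbours; the quadratic ones cancel because the
     squares of the four directions sum to 0. *)
  have S : Re (F0^* * T1) + Re (F0^* * T2) + Re (F0^* * T3) + Re (F0^* * T4) =
     Re (F0^* * (r1 + r2 + r3 + r4)).
    rewrite -!ReD; congr Re; rewrite /T1 /T2 /T3 /T4 !exprMn !sqrrN !sqrCi.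
    by ring.
  have RB : `|Re (F0^* * (r1 + r2 + r3 + r4))| <= k ^+ 2.
    apply: (le_trans (cmod_Re _)); rewrite cmodM cmodJ.
    have Rs : cmod (r1 + r2 + r3 + r4) <= 4 * ((4 * (cmod F0 + 1))^-1 * k ^+ 2).
      have := cmodD (r1 + r2 + r3) r4; have := cmodD (r1 + r2) r3; have := cmodD r1 r2.
      lra.
    apply: (le_trans (ler_wpM2l f00 Rs)).
    have -> : cmod F0 * (4 * ((4 * (cmod F0 + 1))^-1 * k ^+ 2)) =
        cmod F0 / (cmod F0 + 1) * k ^+ 2 by field; rewrite gt_eqF//; lra.
    rewrite -[leRHS]mul1r ler_wpM2r ?sqr_ge0// ler_pdivrMr; lra.
  have k20 : 0 < k ^+ 2 by rewrite exprn_gt0.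
  move: RB; rewrite ler_norml => /andP[RB _].
  move: M1 M2 M3 M4; lra.
move=> x y xL yK.
have H := le_trans (cmax (x, y) (mem_set (iffRL (AE (x, y)) (conj xL yK)))) Hc.
rewrite /v /= in H.
rewrite -addrA; apply: le_trans H.
by rewrite lerDl addr_ge0// sqr_ge0.
Qed.

End IdentityTheorem.

(** * Vanishing on the real line propagates to the upper half of the imaginary axis *)

Section VanishingEntire.
Variable R : realType.
Local Notation C := R[i].
Local Notation Re := (@complex.Re R).
Local Notation Im := (@complex.Im R).
Implicit Types (f g F : C -> C) (x y w h a b c : R) (z D : C).

Lemma ccont_bounded F (L K : R) : ccont F -> 0 <= L -> 0 <= K ->
  exists M : R, forall x y, `|x| <= L -> 0 <= y <= K -> cmod (F (Complex x y)) <= M.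
Proof.
move=> cF L0 K0.
have [|||c _ cmax] := @compact_EVT_max _ R (fun q : R * R => cmod (F (Complex q.1 q.2)))
  (`[- L, L] `*` `[0, K]).
- by exists (0, 0); split => /=; rewrite in_itv /= ?lexx ?K0// L0 andbT; lra.
- by apply: compact_setX; exact: segment_compact.
- exact/continuous_subspaceT/ccont_cmod.
exists (cmod (F (Complex c.1 c.2))) => x y xL yK.
by apply: (cmax (x, y)); apply/mem_set; split; rewrite /= in_itv //= -ler_norml.
Qed.

(* [Re ((L + iz)^2 - 2) <= -1] on the three sides of the rectangle off the real axis,
   whereas this function equals 2 at [z = i b], [b = L - 2]. *)
Definition peak (L c : R) z : C := 1 + RtoC c * ((RtoC L + 'i * z) ^+ 2 - 2).

Lemma peak_ccont L c : ccont (peak L c).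
Proof.
have cD f g : ccont f -> ccont g -> ccont (fun z => f z + g z).
  move=> cf cg z e e0; have e2 : 0 < e / 2 by lra.
  have [d1 d10 h1] := cf z _ e2; have [d2 d20 h2] := cg z _ e2.
  exists (Num.min d1 d2); first by rewrite lt_min d10.
  move=> u; rewrite lt_min => /andP[/h1 H1 /h2 H2].
  by rewrite opprD addrACA (le_lt_trans (cmodD _ _))//; lra.
have ci : ccont (fun z : C => z) by move=> z e e0; exists e.
apply: (cD); first exact: ccont_cst.
apply: ccontM; first exact: ccont_cst.
apply: (cD); last exact: ccont_cst.
apply: ccontX; apply: (cD); first exact: ccont_cst.
by apply: ccontM ci; exact: ccont_cst.
Qed.

Lemma peak_quadratic L c z (h : C) : peak L c (z + h) = peak L c z
  + (2 * 'i * RtoC c * (RtoC L + 'i * z)) * h + (RtoC c * 'i ^+ 2) * h ^+ 2.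
Proof. by rewrite /peak; ring. Qed.

Lemma RtoC2 : RtoC 2 = 2 :> C.
Proof. by rewrite [in LHS]mulr2n RtoCD RtoC1. Qed.

(** With [peak = 1 + c * U], one has Re U <= -1 on these sides and |U| <= N = [2 * L ^+ 2 + 2]. The
    choice c = 1 / N^2 gives |1 + c U|^2 = 1 + 2 c Re U + c^2 |U|^2 <= 1 - 2 c + c. *)
Lemma peak_side L x y : 2 <= L -> `|x| <= L -> 0 <= y <= L - 1 ->
  `|x| = L \/ y = L - 1 -> cmod (peak L ((2 * L ^+ 2 + 2) ^+ 2)^-1 (Complex x y)) <= 1.
Proof.
move=> L2 xL yL side; set c := _^-1.
have x2 : x ^+ 2 <= L ^+ 2.
  by rewrite -real_normK ?num_real// lerXn2r// ?nnegrE//; lra.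
set a := L - y; have a1 : 1 <= a <= L by rewrite /a; lra.
have c0 : 0 < (2 * L ^+ 2 + 2) ^+ 2 by rewrite exprn_gt0//; have := sqr_ge0 L; lra.
have E : peak L c (Complex x y) =
    Complex (1 + c * (a ^+ 2 - x ^+ 2 - 2)) (c * (2 * a * x)).
  rewrite /peak iE /a -RtoC2; apply/eqP; rewrite eq_complex /=.
  by apply/andP; split; apply/eqP; ring.
have u1 : a ^+ 2 - x ^+ 2 - 2 <= -1.
  case: side => [xe|ye]; last by rewrite /a ye; have := sqr_ge0 x; nra.
  have -> : x ^+ 2 = L ^+ 2 by rewrite -xe real_normK ?num_real//.
  nra.
have cp : 0 < c by rewrite invr_gt0.
have cc : c * (2 * L ^+ 2 + 2) ^+ 2 = 1 by rewrite mulVf// gt_eqF.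
rewrite -(@ler_pXn2r _ 2)// ?nnegrE ?cmod_ge0// expr1n E cmod_sqr /=.
set u := a ^+ 2 - x ^+ 2 - 2 in u1 *.
have uv : u ^+ 2 + (2 * a * x) ^+ 2 <= (2 * L ^+ 2 + 2) ^+ 2.
  have -> : u ^+ 2 + (2 * a * x) ^+ 2 = (a ^+ 2 + x ^+ 2) ^+ 2 + 4
    - 4 * (a ^+ 2 - x ^+ 2) by rewrite /u; ring.
  have aL : a ^+ 2 <= L ^+ 2 by rewrite lerXn2r// ?nnegrE; lra.
  have s0 := sqr_ge0 a; have s1 := sqr_ge0 x.
  have : (a ^+ 2 + x ^+ 2) ^+ 2 <= (2 * L ^+ 2) ^+ 2 by rewrite lerXn2r// ?nnegrE; lra.
  have -> : (2 * L ^+ 2 + 2) ^+ 2 = (2 * L ^+ 2) ^+ 2 + 4 + 8 * L ^+ 2 by ring.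
  lra.
have : c * (c * (u ^+ 2 + (2 * a * x) ^+ 2)) <= c * 1.
  by rewrite ler_pM2l// -[leRHS]cc ler_pM2l.
have : c * u <= c * (-1) by rewrite ler_pM2l.
rewrite mulr1 => h1 h2.
have -> : (1 + c * u) ^+ 2 + (c * (2 * a * x)) ^+ 2 =
  1 + 2 * (c * u) + c * (c * (u ^+ 2 + (2 * a * x) ^+ 2)) by ring.
lra.
Qed.

Lemma peak_top c b : peak (b + 2) c (Complex 0 b) = RtoC (1 + 2 * c).
Proof.
by rewrite /peak iE -RtoC2; apply/eqP; rewrite eq_complex /=;
  apply/andP; split; apply/eqP; ring.
Qed.

Lemma vanish_smooth F b : ccont F -> (forall z, peano4 F z) ->
  (forall t : R, F (RtoC t) = 0) -> 0 <= b -> F (Complex 0 b) = 0.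
Proof.
(* The rectangle is [[- L, L]] x [[0, L - 1]], so the point at height [b] lies one unit below its
   top side. *)
move=> cF pF F0 b0; set L := b + 2.
have L2 : 2 <= L by rewrite /L; lra.
have L0 : 0 <= L by lra.
have K0 : 0 <= L - 1 by lra.
have [M HM] := ccont_bounded cF L0 K0.
set c := ((2 * L ^+ 2 + 2) ^+ 2)^-1.
have cp : 0 < c by rewrite invr_gt0 exprn_gt0//; have := sqr_ge0 L; lra.
have M0 : 0 <= M.
  apply: le_trans (HM 0 0 _ _); rewrite ?cmod_ge0 ?normr0 ?lexx//.
pose S := M ^+ 2 + L ^+ 2 + (L - 1) ^+ 2.
(* [S] does not depend on [n]: on the real side the product is 0, and on the other three sides the
   power of [peak] has modulus at most 1. *)
have key n : cmod (F (Complex 0 b)) ^+ 2 * (1 + 2 * c) ^+ n <= S.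
  apply: (@le_trans _ _ (cmod (F (Complex 0 b) * peak L c (Complex 0 b) ^+ n) ^+ 2)).
    rewrite cmodM cmodX peak_top cmodRp; last by lra.
    rewrite exprMn ler_wpM2l ?sqr_ge0// -exprM mulnC exprM.
    rewrite lerXn2r ?nnegrE ?sqr_ge0//; first by lra.
    by rewrite expr2; nra.
  apply: (@weak_maximum R (fun z => F z * peak L c z ^+ n)) => //.
  - by apply: ccontM cF _; apply: ccontX; exact: peak_ccont.
  - move=> z; apply: peano4_mul_quadraticX (pF z) _ => h; exact: peak_quadratic.
  - move=> x y xL yK; have Hxy := HM x y xL yK.
    have side : `|x| = L \/ y = L - 1 ->
        cmod (F (Complex x y) * peak L c (Complex x y) ^+ n) <= M.
      move=> /(peak_side L2 xL yK) P; rewrite cmodM cmodX.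
      apply: (le_trans _ Hxy); rewrite ler_piMr ?cmod_ge0//.
      by apply: exprn_ile1 P; exact: cmod_ge0.
    move=> /or3P[/eqP ?|/eqP y0|/eqP ?].
    + by apply: side; left.
    + by have := F0 x; rewrite /RtoC y0 => ->; rewrite mul0r cmod0.
    + by apply: side; right.
  - by rewrite normr0.
  - by rewrite b0 /L; lra.
apply: cmod_eq0P; apply/eqP; rewrite eq_le cmod_ge0 andbT leNgt; apply/negP => p.
have p2 : 0 < cmod (F (Complex 0 b)) ^+ 2 by rewrite exprn_gt0.
have S0 : 0 <= S by rewrite !addr_ge0 ?sqr_ge0.
set q := cmod _ ^+ 2 in key p2.
pose n := Num.bound (S / (q * (2 * c))).
have qc : 0 < q * (2 * c) by rewrite mulr_gt0// mulr_gt0.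
have nb : S < n%:R * (q * (2 * c)).
  by rewrite -ltr_pdivrMr//; apply: archi_boundP; rewrite divr_ge0// ltW.
(* Bernoulli's inequality: linear growth already exceeds [S] at the chosen [n]. *)
have bern m : 1 + m%:R * (2 * c) <= (1 + 2 * c) ^+ m.
  elim: m => [|m IH]; first by rewrite mul0r addr0 expr0.
  rewrite exprSr -natr1; apply: (@le_trans _ _ ((1 + m%:R * (2 * c)) * (1 + 2 * c))).
    have := ler0n R m; nra.
  by rewrite ler_wpM2r//; lra.
have := key n; have := ler_wpM2l (ltW p2) (bern n); nra.
Qed.

(** [vanish_smooth] kills the integral of [f] over every segment of length [w] to the right of the
    point. If [f] stays within [e / 2] of its value there, [cint_le] bounds that value times [w] by
    [e * w]. *)
Lemma vanish_off_line f b : cdiff f -> (forall t : R, f (RtoC t) = 0) -> 0 <= b ->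
  f (Complex 0 b) = 0.
Proof.
move=> df f0 b0; have cf := cdiff_cont df.
have sm w : 0 <= w -> cint (fun t => f (Complex t b)) 0 (0 + w) = 0.
  move=> w0; rewrite -[LHS]/(smooth f w (Complex 0 b)).
  apply: vanish_smooth => //.
  - exact: smooth_cont.
  - by move=> z; exact: smooth_peano4.
  - move=> t; rewrite /smooth /= (@eq_cint _ _ (fun=> 0)).
      by rewrite cint_cst ?mul0r// lerDl.
    by move=> x _; exact: f0.
apply: cmod_small_eq0 => e e0; have e2 : 0 < e / 2 by lra.
have [del d0 H] := cf (Complex 0 b) _ e2.
have w0 : 0 < del / 2 by lra.
have ce : path_cont (fun t => f (Complex t b)) by exact: hpath_cont.
have cc : path_cont (fun t : R => - f (Complex 0 b)) by exact: path_cont_cst.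
have := @cint_le R (fun t => f (Complex t b) + - f (Complex 0 b)) 0 (0 + del / 2) (e / 2).
rewrite cintD// sm ?(ltW w0)// cint_cst ?add0r ?(ltW w0)// => B.
have := B (path_contD ce cc) isT.
rewrite cmodM cmodN subr0 cmodRp ?(ltW w0)// => {}B.
have : cmod (f (Complex 0 b)) * (del / 2) <= 2 * (e / 2) * (del / 2).
  apply: B => x /andP[x0 xd]; apply/ltW/H.
  rewrite (le_lt_trans (Complex_sub _ _ _ _))// subrr normr0 addr0 subr0 ger0_norm//; lra.
by rewrite ler_pM2r//; lra.
Qed.

End VanishingEntire.

(** * The complex exponential *)

Section ComplexExponential.
Variable R : realType.
Local Notation C := R[i].
Local Notation Re := (@complex.Re R).
Local Notation Im := (@complex.Im R).
Implicit Types (z w k : C).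

Definition cexp z : C :=
  Complex (expR (Re z) * cos (Im z)) (expR (Re z) * sin (Im z)).

Lemma cexpD z w : cexp (z + w) = cexp z * cexp w.
Proof.
rewrite /cexp ReD ImD expRD cosD sinD; apply/eqP; rewrite eq_complex /=.
by apply/andP; split; apply/eqP; ring.
Qed.

Lemma cexp0 : cexp 0 = 1.
Proof. by rewrite /cexp /= expR0 cos0 sin0 mulr1 mulr0. Qed.

Lemma is_derive_little_o (f : R -> R) (x df : R) : is_derive x 1 f df ->
  forall e : R, 0 < e -> exists2 del : R, 0 < del &
    forall h, `|h| < del -> `|f (x + h) - f x - df * h| <= e * `|h|.
Proof.
move=> [dfx dfv] e e0.
have /cvgrPdist_lt/(_ e e0) : h^-1 *: (f (h *: 1 + x) - f x) @[h --> 0^'] --> df.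
  by rewrite -dfv; exact: dfx.
rewrite near_withinE => /nbhs_ballP[del /= d0 H]; exists del => // h hd.
have [->|h0] := eqVneq h 0; first by rewrite addr0 subrr mulr0 subrr normr0 mulr0.
have := H h _ h0; rewrite /ball /= sub0r normrN => /(_ hd).
rewrite /GRing.scale /= mulr1 [h + x]addrC => Hd.
have -> : f (x + h) - f x - df * h = - ((df - h^-1 * (f (x + h) - f x)) * h).
  by field.
by rewrite normrN normrM ler_wpM2r// ltW.
Qed.

Lemma cderiv_cexp0 : cderiv cexp 0 1.
Proof.
(* The four error terms below come to at most 1 + 3 + 3 + 2 = 9 times [e' * cmod u]. The bound
   [e' <= 1] gives [E <= 3], and [cmod u < e'] makes the product [(E - 1) * b] small. *)
move=> e e0; set e' := Num.min 1 (e / 9).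
have e'0 : 0 < e' by rewrite lt_min ltr01 divr_gt0.
have e'1 : e' <= 1 by rewrite ge_min lexx.
have e'e : 9 * e' <= e by rewrite mulrC -ler_pdivlMr// ge_min lexx orbT.
clearbody e'.
have [d1 d10 H1] := is_derive_little_o (is_derive_expR 0) e'0.
have [d2 d20 H2] := is_derive_little_o (is_derive_cos 0) e'0.
have [d3 d30 H3] := is_derive_little_o (is_derive_sin 0) e'0.
exists (Num.min e' (Num.min d1 (Num.min d2 d3))); first by rewrite !lt_min e'0 d10 d20 d30.
move=> u; rewrite cexp0 subr0 mul1r !lt_min => /and4P[ue u1 u2 u3].
have ha := cmod_Re u; have hb := cmod_Im u.
have := H1 _ (le_lt_trans ha u1); have := H2 _ (le_lt_trans hb u2).
have := H3 _ (le_lt_trans hb u3).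
rewrite !add0r expR0 cos0 sin0 subr0 oppr0 mul0r subr0 !mul1r /cexp.
set a := Re u in ha *; set b := Im u in hb *; set E := expR a.
move=> Hs Hc HE; have E0 : 0 < E := expR_gt0 _.
have na := normr_ge0 a; have nb := normr_ge0 b.
have Eb : `|E - 1| <= 2 * `|a|.
  have -> : E - 1 = (E - 1 - a) + a by ring.
  by apply: (le_trans (ler_normD _ _)); nra.
have E3 : E <= 3 by move: Eb; rewrite ler_norml => /andP[_]; lra.
apply: (le_trans (cmod_le _)).
have -> : Complex (E * cos b) (E * sin b) - 1 - u =
   Complex ((E - 1 - a) + E * (cos b - 1)) (E * (sin b - b) + (E - 1) * b).
  rewrite /a /b; case: (u) => p q; apply/eqP; rewrite eq_complex /=.
  by apply/andP; split; apply/eqP; ring.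
rewrite /=.
have r1 : `|E - 1 - a + E * (cos b - 1)| <= e' * `|a| + 3 * (e' * `|b|).
  apply: (le_trans (ler_normD _ _)); apply: lerD => //.
  by rewrite normrM (gtr0_norm E0); apply: ler_pM => //; exact: ltW.
have r2 : `|E * (sin b - b) + (E - 1) * b| <= 3 * (e' * `|b|) + 2 * e' * `|b|.
  apply: (le_trans (ler_normD _ _)); apply: lerD.
    by rewrite normrM (gtr0_norm E0); apply: ler_pM => //; exact: ltW.
  rewrite normrM ler_wpM2r//; lra.
have c0 := cmod_ge0 u.
have k1 : e' * `|a| <= e' * cmod u by rewrite ler_wpM2l// ltW.
have k2 : e' * `|b| <= e' * cmod u by rewrite ler_wpM2l// ltW.
have k3 : 9 * e' * cmod u <= e * cmod u by rewrite ler_wpM2r.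
lra.
Qed.

(** The addition formula [cexpD] reduces the derivative at [z] to the one at 0. *)
Lemma cderiv_cexpZ k z : cderiv (fun v => cexp (k * v)) z (k * cexp (k * z)).
Proof.
move=> e e0; pose q := cmod (cexp (k * z)); have q0 : 0 <= q := cmod_ge0 _.
have kk := cmod_ge0 k.
have e1 : 0 < e / ((q + 1) * (cmod k + 1)).
  by rewrite divr_gt0// mulr_gt0//; lra.
have [d d0 H] := cderiv_cexp0 e1.
exists (d / (cmod k + 1)); first by rewrite divr_gt0//; lra.
move=> u; rewrite ltr_pdivlMr; last by lra.
have := cmod_ge0 (u - z); set h := u - z => h0 hd.
have := H (k * h); rewrite subr0 cexp0 cmodM mul1r => {}H.
have {}H : cmod (cexp (k * h) - 1 - k * h) <=
    e / ((q + 1) * (cmod k + 1)) * (cmod k * cmod h) by apply: H; lra.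
have -> : k * u = k * z + k * h by rewrite /h; ring.
rewrite cexpD.
have -> : cexp (k * z) * cexp (k * h) - cexp (k * z) - k * cexp (k * z) * h =
  cexp (k * z) * (cexp (k * h) - 1 - k * h) by ring.
rewrite cmodM -/q; apply: (le_trans (ler_wpM2l q0 H)).
have -> : q * (e / ((q + 1) * (cmod k + 1)) * (cmod k * cmod h)) =
  e * (q / (q + 1) * (cmod k / (cmod k + 1))) * cmod h.
  by field; rewrite !gt_eqF//; lra.
rewrite ler_wpM2r// -[leRHS]mulr1 ler_wpM2l ?(ltW e0)//.
apply: mulr_ile1; rewrite ?divr_ge0//; try lra.
- by rewrite ler_pdivrMr; lra.
- by rewrite ler_pdivrMr; lra.
Qed.

End ComplexExponential.

Local Open Scope fset_scope.
Local Open Scope ring_scope.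

(** * Unconditional sums *)

Section Sums.
Variables (R : realType) (X : choiceType).
Local Notation C := R[i].
Local Notation Re := (@complex.Re R).
Local Notation Im := (@complex.Im R).
Implicit Types (f g : X -> C) (S T : C) (F G : {fset X}).

Lemma hasSumP f S : hasSum f S <-> forall e : R, 0 < e ->
  exists F0 : {fset X}, forall F, F0 `<=` F -> cmod (\sum_(x <- F) f x - S) < e.
Proof.
split=> [H e e0|H e /gt0_RtoC[r -> r0]].
  have e0' : 0 < RtoC e by rewrite -RtoC0 RtoC_lt.
  have [F0 HF] := H _ e0'; exists F0 => F /HF.
  by rewrite normE RtoC_lt.
have [F0 HF] := H _ r0; exists F0 => F /HF.
by rewrite normE RtoC_lt.
Qed.

Lemma hasSum_unique f S T : hasSum f S -> hasSum f T -> S = T.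
Proof.
move=> /hasSumP HS /hasSumP HT; apply/eqP; rewrite -subr_eq0; apply/eqP.
apply: cmod_small_eq0 => e e0; have e2 : 0 < e / 2 by lra.
have [F HF] := HS _ e2; have [G HG] := HT _ e2.
have := HF (F `|` G) (fsubsetUl _ _); have := HG (F `|` G) (fsubsetUr _ _).
set s := \sum_(x <- _) _ => h1 h2.
have -> : S - T = (s - T) - (s - S) by ring.
by rewrite (le_trans (cmodB _ _))//; lra.
Qed.

Lemma sumX_eq f S : hasSum f S -> sumX f = S.
Proof. by move=> H; rewrite /sumX (xget_unique _ H)// => T /hasSum_unique; exact. Qed.

Lemma hasSumD f g S T : hasSum f S -> hasSum g T ->
  hasSum (fun x => f x + g x) (S + T).
Proof.
move=> /hasSumP HS /hasSumP HT; apply/hasSumP => e e0.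
have e2 : 0 < e / 2 by lra.
have [F HF] := HS _ e2; have [G HG] := HT _ e2.
exists (F `|` G) => K /fsubUsetP[/HF h1 /HG h2].
rewrite big_split /= opprD addrACA (le_lt_trans (cmodD _ _))//; lra.
Qed.

Lemma hasSumZ k f S : hasSum f S -> hasSum (fun x => k * f x) (k * S).
Proof.
move=> /hasSumP HS; apply/hasSumP => e e0.
have k0 : 0 < cmod k + 1 by have := cmod_ge0 k; lra.
have [F HF] := HS _ (divr_gt0 e0 k0); exists F => G /HF.
rewrite -mulr_sumr -mulrBr cmodM ltr_pdivlMr//.
by have := cmod_ge0 (\sum_(i <- G) f i - S); nra.
Qed.

Lemma hasSum_finite f F : (forall x, x \notin F -> f x = 0) ->
  hasSum f (\sum_(x <- F) f x).
Proof.
move=> f0; apply/hasSumP => e e0; exists F => G FG.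
rewrite [X in cmod X](_ : _ = 0) ?cmod0//; apply/eqP; rewrite subr_eq0; apply/eqP.
by apply/esym/big_fset_incl => // x _; exact: f0.
Qed.

Lemma hasSum_point f x : (forall y, y != x -> f y = 0) -> hasSum f (f x).
Proof.
move=> f0; have := @hasSum_finite f [fset x]; rewrite big_seq_fset1; apply.
by move=> y; rewrite inE; exact: f0.
Qed.

Lemma hasSum_cmod_le f S (M : R) : hasSum f S ->
  (exists F0 : {fset X}, forall F, F0 `<=` F -> cmod (\sum_(x <- F) f x) <= M) ->
  cmod S <= M.
Proof.
move=> /hasSumP HS [F0 H]; rewrite leNgt; apply/negP => MS.
have e0 : 0 < cmod S - M by lra.
have [F HF] := HS _ e0.
have := HF (F `|` F0) (fsubsetUl _ _); have := H (F `|` F0) (fsubsetUr _ _).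
set s := \sum_(x <- _) _ => h1 h2.
have : cmod S <= cmod s + cmod (s - S).
  by rewrite {1}(_ : S = s - (s - S)); [exact: cmodB|ring].
lra.
Qed.

Lemma le_fsum (g : X -> R) F G : (forall x, 0 <= g x) -> F `<=` G ->
  \sum_(x <- F) g x <= \sum_(x <- G) g x.
Proof.
move=> g0 FG; rewrite [leRHS](bigID (mem F)) /=.
have -> : \sum_(x <- G | x \in F) g x = \sum_(x <- F) g x.
  rewrite -big_filter; apply: perm_big; apply: uniq_perm.
  - by rewrite filter_uniq.
  - exact: fset_uniq.
  - move=> x; rewrite mem_filter; case xF : (x \in F) => //=.
    by rewrite (fsubsetP FG).
by rewrite lerDl sumr_ge0.
Qed.

Lemma hasSum_nonneg (g : X -> R) (M : R) : (forall x, 0 <= g x) ->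
  (forall F, \sum_(x <- F) g x <= M) -> exists s : R, [/\ 0 <= s, s <= M,
    forall F, \sum_(x <- F) g x <= s & hasSum (fun x => RtoC (g x)) (RtoC s)].
Proof.
move=> g0 gM; pose A := [set r | exists F, r = \sum_(x <- F) g x].
have A0 : A !=set0 by exists (\sum_(x <- fset0 : {fset X}) g x); exists fset0.
have Aub : ubound A M by move=> _ [F ->]; exact: gM.
have hs : has_sup A by split=> //; exists M.
have le F : \sum_(x <- F) g x <= sup A by apply: ub_le_sup; [case: hs|exists F].
exists (sup A); split=> //; first by apply: le_trans (le fset0); rewrite sumr_ge0.
  exact: ge_sup.
apply/hasSumP => e e0; have [_ [F ->] HF] := sup_adherent e0 hs.
exists F => G FG; rewrite -RtoC_sum -RtoCB cmodR distrC ger0_norm ?subr_ge0//.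
by have := le_fsum g0 FG; lra.
Qed.

(** Quantitative absolute summability. As [sumX] has an arbitrary value on families that are not
    summable, its algebraic rules are proved under this hypothesis. *)
Definition abs_bounded f (M : R) := forall F, \sum_(x <- F) cmod (f x) <= M.

(* Write f = (p - n) + i (q - n) with n = |f|, p = |f| + Re f and q = |f| + Im f nonnegative. *)
Lemma abs_bounded_hasSum f M : abs_bounded f M -> hasSum f (sumX f).
Proof.
move=> H; suff [S HS] : exists S, hasSum f S by rewrite (sumX_eq HS).
have M0 : 0 <= M by apply: le_trans (H fset0); rewrite sumr_ge0// => x _; exact: cmod_ge0.
have [n [_ _ _ Hn]] := hasSum_nonneg (fun x => cmod_ge0 (f x)) H.
have part (p : C -> R) : (forall z, `|p z| <= cmod z) ->
    exists s : C, hasSum (fun x => RtoC (cmod (f x) + p (f x))) s.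
  move=> pz; have [||s [_ _ _ Hs]] := @hasSum_nonneg (fun x => cmod (f x) + p (f x)) (2 * M).
  - by move=> x; have := pz (f x); rewrite ler_norml; lra.
  - move=> F; apply: (@le_trans _ _ (\sum_(x <- F) 2 * cmod (f x))).
      by apply: ler_sum => x _; have := pz (f x); rewrite ler_norml; lra.
    by rewrite -mulr_sumr ler_wpM2l.
  by exists (RtoC s).
have [p Hp] := part Re (@cmod_Re _); have [q Hq] := part Im (@cmod_Im _).
have H1 := hasSumD Hp (hasSumZ (-1) Hn).
have H2 := hasSumZ 'i (hasSumD Hq (hasSumZ (-1) Hn)).
eexists; have := hasSumD H1 H2.
rewrite (_ : (fun x => _) = f); first exact.
apply/funext => x; rewrite [RHS]complexRI !RtoCD; ring.
Qed.

Lemma sumX_cmod_le f M : abs_bounded f M -> cmod (sumX f) <= M.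
Proof.
move=> H; apply: hasSum_cmod_le (abs_bounded_hasSum H) _; exists fset0 => F _.
exact: le_trans (cmod_sum _ _ _) (H F).
Qed.

Lemma sumXD f g M N : abs_bounded f M -> abs_bounded g N ->
  sumX (fun x => f x + g x) = sumX f + sumX g.
Proof.
by move=> /abs_bounded_hasSum Hf /abs_bounded_hasSum Hg; exact/sumX_eq/hasSumD.
Qed.

Lemma sumXZ k f M : abs_bounded f M -> sumX (fun x => k * f x) = k * sumX f.
Proof. by move=> /abs_bounded_hasSum Hf; exact/sumX_eq/hasSumZ. Qed.

Lemma sumX_point f x : (forall y, y != x -> f y = 0) -> sumX f = f x.
Proof. by move=> H; exact/sumX_eq/hasSum_point. Qed.

Lemma sumX0 f : (forall x, f x = 0) -> sumX f = 0.
Proof.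
move=> f0; apply: sumX_eq; have := @hasSum_finite f fset0.
by rewrite big_seq_fset0; apply.
Qed.

(** By monotonicity, one partial sum above [cmod S] would keep all larger ones away from [S]. *)
Lemma hasSum_nonneg_ge (g : X -> R) S : (forall x, 0 <= g x) ->
  hasSum (fun x => RtoC (g x)) S ->
  exists s : R, [/\ S = RtoC s, 0 <= s & forall F, \sum_(x <- F) g x <= s].
Proof.
move=> g0 HS.
have bd F : \sum_(x <- F) g x <= cmod S.
  rewrite leNgt; apply/negP => lt; move/hasSumP: (HS) => H.
  have e0 : 0 < \sum_(x <- F) g x - cmod S by lra.
  have [G HG] := H _ e0.
  have := HG (F `|` G) (fsubsetUr _ _); have := le_fsum g0 (fsubsetUl F G).
  rewrite -RtoC_sum; set s := \sum_(x <- F `|` G) g x => h1 h2.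
  have : s <= cmod (RtoC s - S) + cmod S.
    have := cmodD (RtoC s - S) S; rewrite subrK.
    by apply: le_trans; rewrite cmodR ler_norm.
  lra.
have [s [s0 _ le Hs]] := hasSum_nonneg g0 bd.
by exists s; split=> //; exact: hasSum_unique HS Hs.
Qed.

(** One finite set [F] serves all rows in [A]: each row gets the tolerance [e / N] with [N] larger
    than the number of rows. *)
Lemma finite_rows_approx (Y : choiceType) (c : Y -> X -> C) (r : Y -> C) (A : {fset Y}) F0 e :
  0 < e -> (forall y, hasSum (c y) (r y)) ->
  exists2 F, F0 `<=` F &
    cmod (\sum_(y <- A) \sum_(x <- F) c y x - \sum_(y <- A) r y) <= e.
Proof.
move=> e0 Hr; pose N : R := (size A)%:R + 1.
have N0 : 0 < N by rewrite /N ltr_wpDl.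
have /choice[G HG] y : exists G : {fset X}, forall F, G `<=` F ->
    cmod (\sum_(x <- F) c y x - r y) < e / N.
  by have /hasSumP/(_ _ (divr_gt0 e0 N0)) := Hr y.
exists (F0 `|` \bigcup_(y <- A) G y); first exact: fsubsetUl.
rewrite -sumrB; apply: (le_trans (cmod_sum _ _ _)).
apply: (@le_trans _ _ (\sum_(y <- A) e / N)).
  rewrite big_seq [leRHS]big_seq; apply: ler_sum => y yA; apply/ltW/HG.
  by apply: fsubset_trans (fsubsetUr _ _); exact: bigfcup_sup.
rewrite big_const_seq count_predT iter_addr_0 -mulr_natl.
rewrite mulrCA -[leRHS]mulr1 ler_wpM2l ?(ltW e0)// ler_pdivrMr//.
by rewrite mul1r /N lerDl.
Qed.

End Sums.

(** * Exchange of double sums *)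

Section Fubini.
Variables (R : realType) (X Y : choiceType).
Local Notation C := R[i].

Lemma fsum_prod (V : nmodType) (A : {fset X}) (B : {fset Y}) (h : X * Y -> V) :
  \sum_(p <- A `*` B) h p = \sum_(x <- A) \sum_(y <- B) h (x, y).
Proof.
rewrite (perm_big [seq (x, y) | x <- A, y <- B]) /= ?big_allpairs//.
apply: uniq_perm; first exact: fset_uniq.
  by apply: allpairs_uniq => // -[? ?] [? ?].
move=> [x y]; rewrite in_fsetM /=; apply/andP/allpairsP => [[xA yB]|].
  by exists (x, y).
by move=> [[x' y'] [? ? [-> ->]]].
Qed.

(** For [A] containing the first projection of [F0], a large enough [B] makes [A] x [B] contain [F0]
    and makes the truncated row sums nearly exact at the same time. *)
Lemma hasSum_fubini (c : X -> Y -> C) (T : C) (r : X -> C) :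
  hasSum (fun p : X * Y => c p.1 p.2) T -> (forall x, hasSum (c x) (r x)) ->
  hasSum r T.
Proof.
move=> /hasSumP HT Hr; apply/hasSumP => e e0; have e2 : 0 < e / 2 by lra.
have [F0 HF0] := HT _ e2.
exists [fset p.1 | p in F0] => A HA.
have e3 : 0 < e / 4 by lra.
have [B HB happ] := finite_rows_approx A [fset p.2 | p in F0] e3 Hr.
have sub : F0 `<=` A `*` B.
  apply/fsubsetP => -[x y] xy; rewrite in_fsetM /=; apply/andP; split.
    by apply: (fsubsetP HA); apply/imfsetP; exists (x, y).
  by apply: (fsubsetP HB); apply/imfsetP; exists (x, y).
have := HF0 _ sub; rewrite fsum_prod /=.
move: happ; set s1 := \sum_(y <- A) \sum_(x <- B) _; set s2 := \sum_(y <- A) r y.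
move=> h1 h2; have -> : s2 - T = (s1 - T) - (s1 - s2) by ring.
by rewrite (le_lt_trans (cmodB _ _))//; lra.
Qed.

Lemma hasSum_swap (c : X -> Y -> C) (T : C) :
  hasSum (fun p : X * Y => c p.1 p.2) T ->
  hasSum (fun p : Y * X => c p.2 p.1) T.
Proof.
move=> /hasSumP HT; apply/hasSumP => e e0; have [F HF] := HT _ e0.
pose sw (K L : choiceType) (p : K * L) := (p.2, p.1).
exists [fset sw _ _ p | p in F] => G FG.
have := HF [fset sw _ _ p | p in G]; rewrite big_imfset /=; last first.
  by move=> [? ?] [? ?] _ _ [-> ->].
apply; apply/fsubsetP => -[x y] xy; apply/imfsetP; exists (y, x) => //=.
by apply: (fsubsetP FG); apply/imfsetP; exists (x, y).
Qed.

End Fubini.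

Section FubiniSwap.
Variables (R : realType) (X Y : choiceType).
Local Notation C := R[i].

Lemma fubini (c : X -> Y -> C) (M : R) :
  (forall (F : {fset X}) (G : {fset Y}),
     \sum_(x <- F) \sum_(y <- G) cmod (c x y) <= M) ->
  sumX (fun x => sumX (c x)) = sumX (fun y => sumX (c^~ y)).
Proof.
move=> H.
have Hp : abs_bounded (fun p : X * Y => c p.1 p.2) M.
  move=> F; apply: le_trans (H [fset p.1 | p in F] [fset p.2 | p in F]).
  rewrite -(fsum_prod _ _ (fun p => cmod (c p.1 p.2))).
  apply: le_fsum => [p|]; first exact: cmod_ge0.
  apply/fsubsetP => -[x y] xy; rewrite in_fsetM /=; apply/andP; split.
    by apply/imfsetP; exists (x, y).
  by apply/imfsetP; exists (x, y).
have HT := abs_bounded_hasSum Hp.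
have r1 x : hasSum (c x) (sumX (c x)).
  apply: (@abs_bounded_hasSum _ _ _ M) => G.
  by have := H [fset x] G; rewrite big_seq_fset1.
have r2 y : hasSum (c^~ y) (sumX (c^~ y)).
  apply: (@abs_bounded_hasSum _ _ _ M) => F; have := H F [fset y].
  by under eq_bigr do rewrite big_seq_fset1.
rewrite (sumX_eq (hasSum_fubini HT r1)).
by rewrite (sumX_eq (@hasSum_fubini _ _ _ (fun y x => c x y) _ _ (hasSum_swap HT) r2)).
Qed.

End FubiniSwap.

(** * Bounded matrices *)

Section Operators.
Variables (R : realType) (X : choiceType).
Local Notation C := R[i].
Local Notation Re := (@complex.Re R).
Local Notation Im := (@complex.Im R).
Local Notation mx := (mx R X).
Implicit Types (f g u v w xi : X -> C) (S T : C) (F G : {fset X}) (a b : mx) (m n s : R).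

Definition qnorm F u : R := Num.sqrt (\sum_(x <- F) cmod (u x) ^+ 2).

Lemma sum_sqr_ge0 F u : 0 <= \sum_(x <- F) cmod (u x) ^+ 2.
Proof. by rewrite sumr_ge0// => x _; rewrite sqr_ge0. Qed.

Lemma qnorm_ge0 F u : 0 <= qnorm F u. Proof. exact: sqrtr_ge0. Qed.

Lemma qnorm_sqr F u : qnorm F u ^+ 2 = \sum_(x <- F) cmod (u x) ^+ 2.
Proof. by rewrite sqr_sqrtr// sum_sqr_ge0. Qed.

Lemma qnorm_le F u s : 0 <= s -> (qnorm F u <= s) = (\sum_(x <- F) cmod (u x) ^+ 2 <= s ^+ 2).
Proof. by move=> s0; rewrite -qnorm_sqr ler_pXn2r// nnegrE// qnorm_ge0. Qed.

Lemma cauchy_schwarz (I : Type) (r : seq I) (p q : I -> R) :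
  (\sum_(i <- r) p i * q i) ^+ 2 <=
  (\sum_(i <- r) p i ^+ 2) * (\sum_(i <- r) q i ^+ 2).
Proof.
set D := \sum_(i <- r) p i * q i; set A := \sum_(i <- r) p i ^+ 2.
set B := \sum_(i <- r) q i ^+ 2.
have H (s t : R) : 0 <= s ^+ 2 * A - 2 * s * t * D + t ^+ 2 * B.
  have -> : s ^+ 2 * A - 2 * s * t * D + t ^+ 2 * B =
      \sum_(i <- r) (s * p i - t * q i) ^+ 2.
    rewrite /A /B /D !mulr_sumr -sumrB -big_split /=; apply: eq_bigr => i _; ring.
  by rewrite sumr_ge0// => i _; exact: sqr_ge0.
have A0 : 0 <= A by rewrite sumr_ge0// => i _; exact: sqr_ge0.
have B0 : 0 <= B by rewrite sumr_ge0// => i _; exact: sqr_ge0.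
have [Ap|An] := ltP 0 A.
  have h := H D A; rewrite -(ler_pM2l Ap); nra.
have {An}A00 : A = 0 by apply/eqP; rewrite eq_le A0 An.
have [->|Dn0] := eqVneq D 0; first by rewrite expr0n /= mulr_ge0.
(* For [A = 0] the form is affine in [s]; this [s] gives it the value -1. *)
have := H ((B + 1) / (2 * D)) 1; rewrite A00 mulr0.
have -> : 2 * ((B + 1) / (2 * D)) * 1 * D = B + 1 by field.
lra.
Qed.

Lemma sum_cmod_mul_le F u v :
  \sum_(x <- F) cmod (u x) * cmod (v x) <= qnorm F u * qnorm F v.
Proof.
have s0 : 0 <= \sum_(x <- F) cmod (u x) * cmod (v x).
  by rewrite sumr_ge0// => x _; rewrite mulr_ge0 ?cmod_ge0.
rewrite -(@ler_pXn2r _ 2)// ?nnegrE ?mulr_ge0 ?qnorm_ge0//.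
by rewrite exprMn !qnorm_sqr cauchy_schwarz.
Qed.

Lemma cmod_sum_mul_le F u v :
  cmod (\sum_(x <- F) u x * v x) <= qnorm F u * qnorm F v.
Proof.
apply: le_trans (sum_cmod_mul_le F u v); apply: le_trans (cmod_sum _ _ _) _.
by under eq_bigr do rewrite cmodM.
Qed.

Lemma qnorm_dual F w m : 0 <= m ->
  (forall u, cmod (\sum_(x <- F) (u x)^* * w x) <= m * qnorm F u) -> qnorm F w <= m.
Proof.
move=> m0 /(_ w).
under eq_bigr do rewrite cmodJM.
rewrite -RtoC_sum cmodRp ?sum_sqr_ge0// -qnorm_sqr expr2.
have [q0|qp] := leP (qnorm F w) 0; first by move=> _; exact: le_trans q0 m0.
by rewrite ler_pM2r.
Qed.

(** The working form of [op_bound]: a real constant, no squares, and separate finite sets for rows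
    and columns. The two agree because vectors can be extended by zero to the union of the sets. *)
Definition ub a m := 0 <= m /\ forall F G u v,
  cmod (\sum_(x <- F) \sum_(y <- G) (u x)^* * a x y * v y) <= m * qnorm F u * qnorm G v.

Lemma sum_cutoff (V : nmodType) F G (h : X -> V) : F `<=` G ->
  \sum_(x <- G) (if x \in F then h x else 0) = \sum_(x <- F) h x.
Proof.
move=> FG; rewrite -(@big_fset_incl _ _ _ _ _ _ _ FG); last by move=> x _ /negbTE ->.
by rewrite big_seq [RHS]big_seq; apply: eq_bigr => x ->.
Qed.

Lemma op_bound_ub a m : op_bound a (RtoC m) <-> ub a m.
Proof.
have EN (F : {fset X}) (u : X -> C) : \sum_(x <- F) `|u x| ^+ 2 = RtoC (qnorm F u ^+ 2).
  by rewrite qnorm_sqr RtoC_sum; apply: eq_bigr => x _; rewrite normE RtoCX.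
have R0 : (0 <= RtoC m) = (0 <= m) by rewrite -RtoC0 RtoC_le.
split=> [[m0 H]|[m0 H]].
  rewrite R0 in m0.
  split=> // F G u v.
  pose u' x := if x \in F then u x else 0; pose v' x := if x \in G then v x else 0.
  have := H (F `|` G) u' v'; rewrite !EN normE -!RtoCX -!RtoCM RtoC_le.
  have -> : qnorm (F `|` G) u' = qnorm F u.
    rewrite /qnorm; congr Num.sqrt; rewrite -(sum_cutoff _ (fsubsetUl F G)).
    by apply: eq_bigr => x _; rewrite /u'; case: ifP => _; rewrite ?cmod0 ?expr0n.
  have -> : qnorm (F `|` G) v' = qnorm G v.
    rewrite /qnorm; congr Num.sqrt; rewrite -(sum_cutoff _ (fsubsetUr F G)).
    by apply: eq_bigr => x _; rewrite /v'; case: ifP => _; rewrite ?cmod0 ?expr0n.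
  have -> : \sum_(x <- F `|` G) \sum_(y <- F `|` G) (u' x)^* * a x y * v' y =
     \sum_(x <- F) \sum_(y <- G) (u x)^* * a x y * v y.
    rewrite -(sum_cutoff _ (fsubsetUl F G)); apply: eq_bigr => x _; rewrite /u'.
    case: ifP => _; last by rewrite big1// => y _; rewrite conjC0 !mul0r.
    rewrite -(sum_cutoff _ (fsubsetUr F G)); apply: eq_bigr => y _; rewrite /v'.
    by case: ifP => _ //; rewrite mulr0.
  by rewrite -!exprMn ler_pXn2r// ?nnegrE ?mulr_ge0 ?cmod_ge0 ?qnorm_ge0.
split=> [|F u v]; first by rewrite R0.
rewrite !EN normE -!RtoCX -!RtoCM RtoC_le -!exprMn.
by rewrite ler_pXn2r// ?nnegrE ?mulr_ge0 ?cmod_ge0 ?qnorm_ge0.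
Qed.

Lemma op_boundP a (M : C) : op_bound a M -> exists2 m, M = RtoC m & ub a m.
Proof.
by move=> H; have [M0 _] := H; have [m Mm _] := ge0_RtoC M0; exists m => //;
  apply/op_bound_ub; rewrite -Mm.
Qed.

Lemma bounded_opP a : bounded_op a <-> exists m, ub a m.
Proof.
split=> [[M /op_boundP[m _ am]]|[m am]]; first by exists m.
by exists (RtoC m); exact/op_bound_ub.
Qed.

Lemma ub_ge0 a m : ub a m -> 0 <= m. Proof. by case. Qed.

Lemma ub_le a m n : ub a m -> m <= n -> ub a n.
Proof.
move=> [m0 H] mn; split=> [|F G u v]; first exact: le_trans m0 mn.
apply: le_trans (H F G u v) _; rewrite -!mulrA ler_wpM2r// mulr_ge0 ?qnorm_ge0//.
Qed.

Lemma ub_entry a m x y : ub a m -> cmod (a x y) <= m.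
Proof.
move=> [m0 /(_ [fset x] [fset y] (fun=> 1) (fun=> 1))].
have q1 z : qnorm [fset z] (fun=> 1) = 1.
  by rewrite /qnorm big_seq_fset1 cmod1 expr1n sqrtr1.
by rewrite !big_seq_fset1 conjC1 mul1r !q1 !mulr1.
Qed.

Lemma ub_apply a m F G v : ub a m ->
  qnorm F (fun x => \sum_(y <- G) a x y * v y) <= m * qnorm G v.
Proof.
move=> [m0 H]; apply: qnorm_dual; first by rewrite mulr_ge0// qnorm_ge0.
move=> u; have := H F G u v; rewrite mulrAC; congr (cmod _ <= _).
by apply: eq_bigr => x _; rewrite mulr_sumr; apply: eq_bigr => y _; rewrite mulrA.
Qed.

Lemma qnorm_conj F u : qnorm F (fun x => (u x)^*) = qnorm F u.
Proof. by rewrite /qnorm; under eq_bigr do rewrite cmodJ. Qed.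

Lemma ub_adj a m : ub a m -> ub (mx_adj a) m.
Proof.
move=> [m0 H]; split=> // F G u v; rewrite -cmodJ rmorph_sum /=.
rewrite (_ : \sum_(i <- F) _ = \sum_(y <- G) \sum_(x <- F) (v y)^* * a y x * u x).
  by apply: le_trans (H G F v u) _; rewrite mulrAC.
rewrite exchange_big /=; apply: eq_bigr => x _; rewrite rmorph_sum /=.
apply: eq_bigr => y _.
by rewrite /mx_adj !rmorphM /= !conjCK; ring.
Qed.

Lemma ub_apply_adj a m F G u : ub a m ->
  qnorm G (fun y => \sum_(x <- F) (u x)^* * a x y) <= m * qnorm F u.
Proof.
move=> /ub_adj/(ub_apply G F u); rewrite -qnorm_conj; congr (qnorm _ _ <= _).
apply/funext => y; rewrite rmorph_sum /=; apply: eq_bigr => x _.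
by rewrite rmorphM /= /mx_adj conjCK mulrC.
Qed.

Lemma ub_row a m x G : ub a m -> qnorm G (a x) <= m.
Proof.
move=> /(ub_apply_adj [fset x] G (fun=> 1)).
rewrite {2}/qnorm big_seq_fset1 cmod1 expr1n sqrtr1 mulr1.
by congr (qnorm _ _ <= _); apply/funext => y; rewrite big_seq_fset1 conjC1 mul1r.
Qed.

Lemma ub_col a m y F : ub a m -> qnorm F (a^~ y) <= m.
Proof.
move=> /(ub_apply F [fset y] (fun=> 1)).
rewrite {2}/qnorm big_seq_fset1 cmod1 expr1n sqrtr1 mulr1.
by congr (qnorm _ _ <= _); apply/funext => x; rewrite big_seq_fset1 mulr1.
Qed.

Lemma ub_add a b m n : ub a m -> ub b n -> ub (mx_add a b) (m + n).
Proof.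
move=> [m0 Ha] [n0 Hb]; split=> [|F G u v]; first exact: addr_ge0.
have -> : \sum_(x <- F) \sum_(y <- G) (u x)^* * mx_add a b x y * v y =
    \sum_(x <- F) \sum_(y <- G) (u x)^* * a x y * v y +
    \sum_(x <- F) \sum_(y <- G) (u x)^* * b x y * v y.
  rewrite -big_split /=; apply: eq_bigr => x _; rewrite -big_split /=.
  by apply: eq_bigr => y _; rewrite /mx_add; ring.
by rewrite (le_trans (cmodD _ _))// !mulrDl lerD.
Qed.

Lemma ub_scale (k : C) a m : ub a m -> ub (mx_scale k a) (cmod k * m).
Proof.
move=> [m0 Ha]; split=> [|F G u v]; first by rewrite mulr_ge0// cmod_ge0.
have -> : \sum_(x <- F) \sum_(y <- G) (u x)^* * mx_scale k a x y * v y =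
    k * \sum_(x <- F) \sum_(y <- G) (u x)^* * a x y * v y.
  rewrite mulr_sumr; apply: eq_bigr => x _; rewrite mulr_sumr.
  by apply: eq_bigr => y _; rewrite /mx_scale; ring.
by rewrite cmodM -!mulrA ler_wpM2l ?cmod_ge0// mulrA.
Qed.

Lemma mx_subE a b : mx_sub a b = mx_add a (mx_scale (-1) b).
Proof. by apply/funext => x; apply/funext => y; rewrite /mx_add /mx_scale mulN1r. Qed.

Lemma ub_sub a b m n : ub a m -> ub b n -> ub (mx_sub a b) (m + n).
Proof.
move=> Ha Hb; rewrite mx_subE; apply: ub_add => //.
by have := ub_scale (-1) Hb; rewrite cmodN cmod1 mul1r.
Qed.

Lemma mul_abs_bounded a b m n x z : ub a m -> ub b n ->
  abs_bounded (fun y => a x y * b y z) (m * n).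
Proof.
move=> Ha Hb F; under eq_bigr do rewrite cmodM.
apply: le_trans (sum_cmod_mul_le F (a x) (b^~ z)) _.
by apply: ler_pM; rewrite ?qnorm_ge0//; [exact: ub_row|exact: ub_col].
Qed.

Lemma mul_hasSum a b m n x z : ub a m -> ub b n ->
  hasSum (fun y => a x y * b y z) (mx_mul a b x z).
Proof. by move=> Ha Hb; exact: abs_bounded_hasSum (mul_abs_bounded x z Ha Hb). Qed.

Lemma hasSum_sum (I : Type) (r : seq I) (h : I -> X -> C) (S : I -> C) :
  (forall i, hasSum (h i) (S i)) ->
  hasSum (fun x => \sum_(i <- r) h i x) (\sum_(i <- r) S i).
Proof.
move=> H; elim: r => [|i r IH].
  rewrite big_nil; have := @hasSum_finite R X (fun=> 0) fset0.
  rewrite big_seq_fset0 => /(_ (fun _ _ => erefl)).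
  by congr hasSum; apply/funext => x; rewrite big_nil.
rewrite big_cons; have := hasSumD (H i) IH.
by congr hasSum; apply/funext => x; rewrite big_cons.
Qed.

(** Expanding the product turns the form into the sum over [y] of (u^* a)_y (b v)_y, whose partial
    sums are bounded by Cauchy-Schwarz; the bound survives in the limit. *)
Lemma ub_mul a b m n : ub a m -> ub b n -> ub (mx_mul a b) (m * n).
Proof.
move=> Ha Hb; have m0 := ub_ge0 Ha; have n0 := ub_ge0 Hb.
split=> [|F G u v]; first exact: mulr_ge0.
have H : hasSum (fun y => \sum_(x <- F) \sum_(z <- G) ((u x)^* * v z) * (a x y * b y z))
    (\sum_(x <- F) \sum_(z <- G) (u x)^* * mx_mul a b x z * v z).
  apply: hasSum_sum => x; apply: hasSum_sum => z.
  by rewrite mulrAC; apply: hasSumZ; exact: mul_hasSum Ha Hb.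
apply: hasSum_cmod_le H _; exists fset0 => K _.
have -> : \sum_(y <- K) \sum_(x <- F) \sum_(z <- G) (u x)^* * v z * (a x y * b y z) =
   \sum_(y <- K) (\sum_(x <- F) (u x)^* * a x y) * (\sum_(z <- G) b y z * v z).
  apply: eq_bigr => y _; rewrite mulr_suml; apply: eq_bigr => x _.
  by rewrite mulr_sumr; apply: eq_bigr => z _; ring.
apply: le_trans (cmod_sum_mul_le _ _ _) _.
have -> : m * n * qnorm F u * qnorm G v = (m * qnorm F u) * (n * qnorm G v) by ring.
by apply: ler_pM; rewrite ?qnorm_ge0//; [exact: ub_apply_adj|exact: ub_apply].
Qed.

Lemma mx_mulBl a a' b m m' n : ub a m -> ub a' m' -> ub b n ->
  mx_mul (mx_sub a a') b = mx_sub (mx_mul a b) (mx_mul a' b).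
Proof.
move=> Ha Ha' Hb; apply/funext => x; apply/funext => z; apply: sumX_eq.
have := hasSumD (mul_hasSum x z Ha Hb) (hasSumZ (-1) (mul_hasSum x z Ha' Hb)).
rewrite mulN1r; congr hasSum.
by apply/funext => y; rewrite /mx_sub; ring.
Qed.

Lemma mx_mulBr a b b' m n n' : ub a m -> ub b n -> ub b' n' ->
  mx_mul a (mx_sub b b') = mx_sub (mx_mul a b) (mx_mul a b').
Proof.
move=> Ha Hb Hb'; apply/funext => x; apply/funext => z; apply: sumX_eq.
have := hasSumD (mul_hasSum x z Ha Hb) (hasSumZ (-1) (mul_hasSum x z Ha Hb')).
rewrite mulN1r; congr hasSum.
by apply/funext => y; rewrite /mx_sub; ring.
Qed.

Definition l2b xi s := 0 <= s /\ forall F, qnorm F xi <= s.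

Lemma apply_hasSum a m xi s x : ub a m -> l2b xi s ->
  hasSum (fun y => a x y * xi y) (mx_apply a xi x).
Proof.
move=> Ha [s0 Hx]; apply: (@abs_bounded_hasSum _ _ _ (m * s)) => F.
under eq_bigr do rewrite cmodM.
apply: le_trans (sum_cmod_mul_le F (a x) xi) _.
by apply: ler_pM; rewrite ?qnorm_ge0//; exact: ub_row.
Qed.

Lemma l2b_apply a m xi s : ub a m -> l2b xi s -> l2b (mx_apply a xi) (m * s).
Proof.
move=> Ha Hx; have [s0 Hs] := Hx; have m0 := ub_ge0 Ha.
split=> [|F]; first exact: mulr_ge0.
apply: qnorm_dual => [|u]; first exact: mulr_ge0.
have H : hasSum (fun y => \sum_(x <- F) (u x)^* * (a x y * xi y))
    (\sum_(x <- F) (u x)^* * mx_apply a xi x).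
  by apply: hasSum_sum => x; apply: hasSumZ; exact: apply_hasSum Ha Hx.
apply: hasSum_cmod_le H _; exists fset0 => K _.
have -> : \sum_(y <- K) \sum_(x <- F) (u x)^* * (a x y * xi y) =
    \sum_(y <- K) (\sum_(x <- F) (u x)^* * a x y) * xi y.
  apply: eq_bigr => y _; rewrite mulr_suml; apply: eq_bigr => x _; ring.
apply: le_trans (cmod_sum_mul_le _ _ _) _.
have -> : m * s * qnorm F u = m * qnorm F u * s by ring.
by apply: ler_pM; rewrite ?qnorm_ge0//; exact: ub_apply_adj.
Qed.

Lemma l2b_norm2 xi s : l2b xi s ->
  exists t, [/\ l2norm2 xi = RtoC t, 0 <= t, t <= s ^+ 2,
    hasSum (fun x => RtoC (cmod (xi x) ^+ 2)) (RtoC t) &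
    forall F, \sum_(x <- F) cmod (xi x) ^+ 2 <= t].
Proof.
move=> [s0 H]; have [||t [t0 ts Ht HS]] := @hasSum_nonneg R X (fun x => cmod (xi x) ^+ 2) (s ^+ 2).
- by move=> x; exact: sqr_ge0.
- by move=> F; rewrite -qnorm_le.
exists t; split=> //; apply: sumX_eq.
by move: HS; congr hasSum; apply/funext => x; rewrite normE RtoCX.
Qed.

Lemma l2_l2b xi : l2 xi -> exists s, l2b xi s.
Proof.
move=> [S HS].
have {}HS : hasSum (fun x => RtoC (cmod (xi x) ^+ 2)) S.
  by move: HS; congr hasSum; apply/funext => x; rewrite normE RtoCX.
have [|t [_ t0 Ht]] := hasSum_nonneg_ge _ HS; first by move=> x; exact: sqr_ge0.
exists (Num.sqrt t); split=> [|F]; first exact: sqrtr_ge0.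
by rewrite /qnorm ler_sqrt.
Qed.

End Operators.

(** * The uniform Roe algebra and the flow *)

Section UniformRoeAlgebra.
Variables (R : realType) (X : choiceType) (d : X -> X -> R).
Hypothesis dm : is_metric d.
Local Notation C := R[i].
Local Notation mx := (mx R X).
Implicit Types (F G : {fset X}) (a b : mx) (m n s : R) (k : C).

Lemma CuP a : Cu d a <-> (exists m, ub a m) /\ forall e, 0 < e ->
  exists b n, [/\ ub b n, finite_prop d b & ub (mx_sub a b) e].
Proof.
split=> [[/bounded_opP Ha H]|[/bounded_opP Ha H]]; split=> // e e0.
  have e0' : 0 < RtoC e by rewrite -RtoC0 RtoC_lt.
  have [b [/bounded_opP[n Hb] fb /op_bound_ub Hab]] := H _ e0'.
  by exists b, n.
have [r -> r0] := gt0_RtoC e0; have [b [n [Hb fb Hab]]] := H _ r0.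
by exists b; split=> //; [apply/bounded_opP; exists n|exact/op_bound_ub].
Qed.

Lemma Cu_ub a : Cu d a -> exists m, ub a m.
Proof. by case/CuP. Qed.

Lemma ub0 : ub ((fun _ _ => 0) : mx) 0.
Proof.
split=> // F G u v; rewrite !mul0r big1 ?cmod0// => x _.
by rewrite big1// => y _; rewrite mulr0 mul0r.
Qed.


Lemma ub_subrr a e : 0 <= e -> ub (mx_sub a a) e.
Proof.
move=> e0; have -> : mx_sub a a = fun _ _ => 0.
  by apply/funext => x; apply/funext => y; rewrite /mx_sub subrr.
exact: ub_le ub0 e0.
Qed.

Lemma Cu_finite_prop a m : ub a m -> finite_prop d a -> Cu d a.
Proof.
move=> Ha fa; apply/CuP; split=> [|e e0]; first by exists m.
by exists a, m; split=> //; apply: ub_subrr; exact: ltW.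
Qed.

Lemma finite_prop_add a b : finite_prop d a -> finite_prop d b ->
  finite_prop d (mx_add a b).
Proof.
move=> [r Hr] [s Hs]; exists (Num.max r s) => x y; rewrite /mx_add le_max => ab0.
have [a0|a0] := eqVneq (a x y) 0; last by rewrite Hr.
by rewrite Hs ?orbT//; move: ab0; rewrite a0 add0r.
Qed.

Lemma Cu_add a b : Cu d a -> Cu d b -> Cu d (mx_add a b).
Proof.
move=> /CuP[[m Ha] Aa] /CuP[[n Hb] Ab]; apply/CuP; split=> [|e e0].
  by exists (m + n); exact: ub_add.
have e2 : 0 < e / 2 by lra.
have [a' [m' [Ha' fa' Haa']]] := Aa _ e2; have [b' [n' [Hb' fb' Hbb']]] := Ab _ e2.
exists (mx_add a' b'), (m' + n'); split; [exact: ub_add|exact: finite_prop_add|].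
have -> : mx_sub (mx_add a b) (mx_add a' b') = mx_add (mx_sub a a') (mx_sub b b').
  by apply/funext => x; apply/funext => y; rewrite /mx_sub /mx_add; ring.
by apply: ub_le (ub_add Haa' Hbb') _; lra.
Qed.

Lemma Cu_scale k a : Cu d a -> Cu d (mx_scale k a).
Proof.
move=> /CuP[[m Ha] Aa]; apply/CuP; split=> [|e e0].
  by exists (cmod k * m); exact: ub_scale.
have k0 := cmod_ge0 k; have k1 : 0 < cmod k + 1 by lra.
have [a' [m' [Ha' [r Hr] Haa']]] := Aa _ (divr_gt0 e0 k1).
exists (mx_scale k a'), (cmod k * m'); split; first exact: ub_scale.
  by exists r => x y; rewrite /mx_scale mulf_eq0 negb_or => /andP[_]; exact: Hr.
have -> : mx_sub (mx_scale k a) (mx_scale k a') = mx_scale k (mx_sub a a').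
  by apply/funext => x; apply/funext => y; rewrite /mx_sub /mx_scale; ring.
apply: ub_le (ub_scale k Haa') _.
by rewrite mulrCA ler_piMr ?(ltW e0)// ler_pdivrMr//; lra.
Qed.

Lemma Cu_adj a : Cu d a -> Cu d (mx_adj a).
Proof.
move=> /CuP[[m Ha] Aa]; apply/CuP; split=> [|e e0]; first by exists m; exact: ub_adj.
have [a' [m' [Ha' [r Hr] Haa']]] := Aa _ e0.
exists (mx_adj a'), m'; split; first exact: ub_adj.
  by exists r => x y; case: dm => _ _ dC _; rewrite /mx_adj conjC_eq0 dC; exact: Hr.
have -> : mx_sub (mx_adj a) (mx_adj a') = mx_adj (mx_sub a a').
  by apply/funext => x; apply/funext => y; rewrite /mx_sub /mx_adj rmorphB.
exact: ub_adj.
Qed.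

Lemma finite_prop_mul a b : finite_prop d a -> finite_prop d b ->
  finite_prop d (mx_mul a b).
Proof.
move=> [r Hr] [s Hs]; exists (r + s) => x z; apply: contraNT => dxz.
apply/eqP/sumX0 => y; have [a0|a0] := eqVneq (a x y) 0; first by rewrite a0 mul0r.
have [b0|b0] := eqVneq (b y z) 0; first by rewrite b0 mulr0.
exfalso; move/negP: dxz; apply; case: dm => _ _ _ dt.
by apply: le_trans (dt x y z) _; apply: lerD; [exact: Hr|exact: Hs].
Qed.

Lemma Cu_mul a b : Cu d a -> Cu d b -> Cu d (mx_mul a b).
Proof.
move=> /CuP[[m Ha] Aa] /CuP[[n Hb] Ab]; apply/CuP; split=> [|e e0].
  by exists (m * n); exact: ub_mul.
have n0 := ub_ge0 Hb; have n1 : 0 < n + 1 by lra.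
have e2 : 0 < e / 2 by lra.
(* [a] is approximated first, since the accuracy required of [b'] depends on the bound [m'] of [a']:
   ab - a'b' = (a - a')b + a'(b - b'). *)
have [a' [m' [Ha' fa' Haa']]] := Aa _ (divr_gt0 e2 n1).
have m0' := ub_ge0 Ha'; have m1' : 0 < m' + 1 by lra.
have [b' [n' [Hb' fb' Hbb']]] := Ab _ (divr_gt0 e2 m1').
exists (mx_mul a' b'), (m' * n'); split; [exact: ub_mul|exact: finite_prop_mul|].
have -> : mx_sub (mx_mul a b) (mx_mul a' b') =
    mx_add (mx_mul (mx_sub a a') b) (mx_mul a' (mx_sub b b')).
  rewrite (mx_mulBl Ha Ha' Hb) (mx_mulBr Ha' Hb Hb').
  by apply/funext => x; apply/funext => y; rewrite /mx_sub /mx_add; ring.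
apply: ub_le (ub_add (ub_mul Haa' Hb) (ub_mul Ha' Hbb')) _.
have h1 : e / 2 / (n + 1) * n <= e / 2.
  rewrite mulrAC ler_pdivrMr//; nra.
have h2 : m' * (e / 2 / (m' + 1)) <= e / 2.
  rewrite mulrA ler_pdivrMr//; nra.
lra.
Qed.

Lemma ub_one : ub (@mx_one R X) 1.
Proof.
split=> // F G u v; rewrite mul1r.
have -> : \sum_(x <- F) \sum_(y <- G) (u x)^* * mx_one R x y * v y =
    \sum_(x <- F `&` G) (u x)^* * v x.
  rewrite -(sum_cutoff _ (fsubsetIl F G)) big_seq [RHS]big_seq.
  apply: eq_bigr => x xF; rewrite in_fsetI xF /=.
  case: ifP => xG; last first.
    rewrite big_seq big1// => y yG; rewrite /mx_one.
    by case: eqP => [xy|_]; [rewrite xy yG in xG|rewrite mulr0 mul0r].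
  rewrite (bigD1_seq x) ?fset_uniq//= /mx_one eqxx mulr1 big1 ?addr0// => y.
  by rewrite eq_sym => /negbTE ->; rewrite mulr0 mul0r.
apply: le_trans (cmod_sum_mul_le _ _ _) _; rewrite qnorm_conj.
by apply: ler_pM; rewrite ?qnorm_ge0// /qnorm ler_sqrt ?sum_sqr_ge0//;
  apply: le_fsum => [x|]; rewrite ?sqr_ge0// ?fsubsetIl ?fsubsetIr.
Qed.

Lemma Cu_one : Cu d (@mx_one R X).
Proof.
apply: Cu_finite_prop ub_one _; exists 0 => x y; rewrite /mx_one.
by case: (x =P y) => [->|]; rewrite ?eqxx//; case: dm => _ d0 _ _ _; rewrite (iffRL (d0 y y)).
Qed.

(** The product of [a] with the coordinate projection onto [P], written without an infinite sum. *)
Definition colr a (P : pred X) : mx := fun x y => if P y then a x y else 0.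

Lemma ub_colr a m P : ub a m -> ub (colr a P) m.
Proof.
move=> [m0 H]; split=> // F G u v.
pose v' y := if P y then v y else 0.
have -> : \sum_(x <- F) \sum_(y <- G) (u x)^* * colr a P x y * v y =
   \sum_(x <- F) \sum_(y <- G) (u x)^* * a x y * v' y.
  apply: eq_bigr => x _; apply: eq_bigr => y _.
  by rewrite /colr /v'; case: (P y); rewrite ?mulr0 ?mul0r.
apply: le_trans (H F G u v') _; rewrite ler_wpM2l ?mulr_ge0 ?qnorm_ge0//.
rewrite /qnorm ler_sqrt ?sum_sqr_ge0//; apply: ler_sum => y _; rewrite /v'.
by case: (P y); rewrite // cmod0 expr0n /= sqr_ge0.
Qed.

Lemma Cu_colr a P : Cu d a -> Cu d (colr a P).
Proof.
move=> /CuP[[m Ha] Aa]; apply/CuP; split=> [|e e0].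
  by exists m; exact: ub_colr.
have [a' [m' [Ha' [r Hr] Haa']]] := Aa _ e0.
exists (colr a' P), m'; split; first exact: ub_colr.
  by exists r => x y; rewrite /colr; case: (P y); [exact: Hr|rewrite eqxx].
have -> : mx_sub (colr a P) (colr a' P) = colr (mx_sub a a') P.
  apply/funext => x; apply/funext => y; rewrite /mx_sub /colr.
  by case: (P y) => //; rewrite subrr.
exact: ub_colr.
Qed.

Definition mxunit (x y : X) : mx := fun i j => if (i == x) && (j == y) then 1 else 0.

Lemma ub_mxunit x y : ub (mxunit x y) 1.
Proof.
split=> // F G u v; rewrite mul1r.
have dl (K : {fset X}) (z : X) (w : X -> C) : z \in K -> cmod (w z) <= qnorm K w.
  move=> zK; rewrite -(@ler_pXn2r _ 2)// ?nnegrE ?cmod_ge0 ?qnorm_ge0// qnorm_sqr.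
  have <- : \sum_(t <- [fset z]) cmod (w t) ^+ 2 = cmod (w z) ^+ 2 by rewrite big_seq_fset1.
  by apply: le_fsum => [t|]; rewrite ?sqr_ge0// fsub1set.
have [xF|xF] := boolP (x \in F); last first.
  rewrite big_seq big1 ?cmod0 ?mulr_ge0 ?qnorm_ge0// => i iF; rewrite big1// => j _.
  rewrite /mxunit; case: eqP => [ix|_]; last by rewrite mulr0 mul0r.
  by rewrite -ix iF in xF.
have [yG|yG] := boolP (y \in G); last first.
  rewrite big1 ?cmod0 ?mulr_ge0 ?qnorm_ge0// => i _; rewrite big_seq big1// => j jG.
  rewrite /mxunit andbC; case: eqP => [jy|_]; last by rewrite mulr0 mul0r.
  by rewrite -jy jG in yG.
have -> : \sum_(i <- F) \sum_(j <- G) (u i)^* * mxunit x y i j * v j = (u x)^* * v y.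
  rewrite (bigD1_seq x) ?fset_uniq//= (bigD1_seq y) ?fset_uniq//=.
  rewrite /mxunit !eqxx /= mulr1 big1 ?addr0; last first.
    by move=> j /negbTE ->; rewrite mulr0 mul0r.
  rewrite big1 ?addr0// => i /negbTE ->; rewrite big1// => j _.
  by rewrite mulr0 mul0r.
rewrite cmodM cmodJ; apply: ler_pM; rewrite ?cmod_ge0//; exact: dl.
Qed.

Lemma finite_prop_mxunit x y : finite_prop d (mxunit x y).
Proof.
exists (d x y) => i j; rewrite /mxunit.
by case: andP => [[/eqP -> /eqP ->]//|_]; rewrite eqxx.
Qed.

Lemma Cu_mxunit x y : Cu d (mxunit x y).
Proof. exact: Cu_finite_prop (ub_mxunit x y) (finite_prop_mxunit x y). Qed.

Lemma mul_diagl (f : X -> C) a x z : mx_mul (mx_diag f) a x z = f x * a x z.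
Proof.
rewrite /mx_mul (@sumX_point _ _ _ x) /mx_diag ?eqxx// => y.
by rewrite eq_sym => /negbTE ->; rewrite mul0r.
Qed.

Lemma mul_diagr (f : X -> C) a x z : mx_mul a (mx_diag f) x z = a x z * f z.
Proof.
rewrite /mx_mul (@sumX_point _ _ _ z) /mx_diag ?eqxx// => y.
by move=> /negbTE ->; rewrite mulr0.
Qed.

(** Written with [cexp] so that the right-hand side makes sense for complex [t]. *)
Lemma sigmaE (h : X -> R) t a x y :
  sigma h t a x y = cexp ('i * RtoC (h x - h y) * RtoC t) * a x y.
Proof.
have E (s : R) : expi s = cexp ('i * RtoC s).
  have -> : 'i * RtoC s = Complex 0 s.
    by rewrite iE; apply/eqP; rewrite eq_complex /=; apply/andP; split; apply/eqP; ring.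
  by rewrite /expi /cexp /= expR0 !mul1r.
rewrite /sigma mul_diagl mul_diagr !E mulrCA -cexpD mulrC.
by congr (cexp _ * _); rewrite RtoCN !RtoCM RtoCB; ring.
Qed.

Lemma entire_entry_cdiff (F : C -> mx) x y : entire d F -> cdiff (fun z => F z x y).
Proof.
move=> [_ HF] z; have [D HD] := HF z; exists (D x y) => e e0.
have e0' : 0 < RtoC e by rewrite -RtoC0 RtoC_lt.
have [del [/gt0_RtoC[r -> r0] H]] := HD _ e0'; exists r => // u ur.
have [->|uz] := eqVneq u z; first by rewrite !subrr mulr0 subrr cmod0 mulr0.
have uz0 : u - z != 0 by rewrite subr_eq0.
have /op_bound_ub/(ub_entry x y) := H u ltac:(by rewrite normr_gt0 uz0 normE RtoC_lt).
rewrite /mx_sub /mx_scale.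
have -> : F u x y - F z x y - D x y * (u - z) =
   ((u - z)^-1 * (F u x y - F z x y) - D x y) * (u - z) by field.
by rewrite cmodM => ?; rewrite ler_wpM2r// cmod_ge0.
Qed.

Lemma cdiff_cexpZ k l : cdiff (fun z => l * cexp (k * z)).
Proof.
by apply: cdiffZ => z; exists (k * cexp (k * z)); exact: cderiv_cexpZ.
Qed.

(** Each entry is compared with the explicit entire function exp(i (h x - h y) z) [b x y]. The
    difference vanishes on the real line, hence at i beta, whichever extension [F] is given. *)
Lemma entire_ext_beta (h : X -> R) (beta : R) b (F : C -> mx) x y : 0 <= beta ->
  entire_ext d h b F ->
  F ('i * RtoC beta) x y = RtoC (expR (- (beta * (h x - h y)))) * b x y.
Proof.
move=> b0 [eF Fb]; pose k : C := 'i * RtoC (h x - h y).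
pose f z := F z x y + (- b x y) * cexp (k * z).
have df : cdiff f by apply: cdiffD (cdiff_cexpZ _ _); exact: entire_entry_cdiff.
have f0 t : f (RtoC t) = 0 by rewrite /f Fb sigmaE -/k; ring.
have := vanish_off_line df f0 b0.
have -> : Complex 0 beta = 'i * RtoC beta.
  by rewrite iE; apply/eqP; rewrite eq_complex /=; apply/andP; split; apply/eqP; ring.
rewrite /f => /eqP; rewrite mulNr subr_eq0 => /eqP ->; rewrite mulrC; congr (_ * _).
have -> : k * ('i * RtoC beta) = RtoC (- (beta * (h x - h y))).
  rewrite RtoCN RtoCM -mulN1r -(@sqrCi C) /k; ring.
by rewrite /cexp /= cos0 sin0 mulr1 mulr0.
Qed.

(** Matrix units are therefore analytic, and the KMS condition can be tested on them.
    Differentiability reduces to that of the scalar factor, since a matrix unit has norm at most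
    1. *)
Lemma mxunit_entire_ext (h : X -> R) x y : entire_ext d h (mxunit x y)
  (fun z => mx_scale (cexp ('i * RtoC (h x - h y) * z)) (mxunit x y)).
Proof.
split; last first.
  move=> t; apply/funext => i; apply/funext => j; rewrite sigmaE /mx_scale /mxunit.
  by case: andP => [[/eqP -> /eqP ->]//|_]; rewrite !mulr0.
split=> [z|z]; first exact/Cu_scale/Cu_mxunit.
set k := 'i * _; exists (mx_scale (k * cexp (k * z)) (mxunit x y)) => e.
move=> /gt0_RtoC[r -> r0]; have [del d0 H] := cderiv_cexpZ k z r0.
exists (RtoC del); split=> [|u]; first by rewrite -RtoC0 RtoC_lt.
rewrite normr_gt0 normE RtoC_lt => /andP[uz ud]; apply/op_bound_ub.
set q := (u - z)^-1 * (cexp (k * u) - cexp (k * z)) - k * cexp (k * z).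
have -> : mx_sub (mx_scale (u - z)^-1 (mx_sub (mx_scale (cexp (k * u)) (mxunit x y))
    (mx_scale (cexp (k * z)) (mxunit x y)))) (mx_scale (k * cexp (k * z)) (mxunit x y))
  = mx_scale q (mxunit x y).
  by apply/funext => i; apply/funext => j; rewrite /mx_sub /mx_scale /q; ring.
apply: ub_le (ub_scale q (ub_mxunit x y)) _; rewrite mulr1.
have uz0 := cmod_gt0 uz; rewrite -(ler_pM2r uz0) -cmodM; apply: le_trans (H u ud).
by rewrite le_eqVlt; apply/orP; left; apply/eqP; congr cmod; rewrite /q; field.
Qed.

End UniformRoeAlgebra.

(** * Gibbs states *)

Section Gibbs.
Variables (R : realType) (X : choiceType) (x0 : X) (d : X -> X -> R) (h : X -> R) (beta : R).
Hypothesis dm : is_metric d.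
Hypothesis beta0 : 0 <= beta.
Local Notation C := R[i].
Local Notation mx := (mx R X).
Implicit Types (F G : {fset X}) (a b : mx) (m n s : R) (k : C).

Definition weight (x : X) : R := expR (- (beta * h x)).

Lemma weight_gt0 x : 0 < weight x. Proof. exact: expR_gt0. Qed.
Lemma weight_ge0 x : 0 <= weight x. Proof. exact: expR_ge0. Qed.

Lemma fsum_fset F : (\sum_(x \in [set` F]) (weight x)%:E)%E =
  (\sum_(x <- F) weight x)%:E.
Proof. by rewrite fsbig_finite/= ?set_fsetK ?sumEFin//; exact: finite_fset. Qed.

Lemma Zpart_ge F : ((\sum_(x <- F) weight x)%:E <= Zpart h beta)%E.
Proof. by apply: esum_ge; exists [set` F]; rewrite ?fsum_fset//; split=> //; exact: finite_fset. Qed.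

Lemma Zpart_le s : (forall F, \sum_(x <- F) weight x <= s) -> (Zpart h beta <= s%:E)%E.
Proof.
move=> H; apply: ge_ereal_sup => _ [A [finA _] <-].
by rewrite -(fset_setK finA) fsum_fset lee_fin.
Qed.

Lemma Zpart_finite : (Zpart h beta < +oo)%E -> exists2 W : R, Zpart h beta = W%:E &
  [/\ 0 < W, forall F, \sum_(x <- F) weight x <= W &
      hasSum (fun x => RtoC (weight x)) (RtoC W)].
Proof.
move=> Zfin.
have Z0 : (0%:E <= Zpart h beta)%E by have := Zpart_ge fset0; rewrite big_seq_fset0.
have [W ZW] : exists r, Zpart h beta = r%:E.
  by case: (Zpart h beta) Zfin Z0 => // r _ _; exists r.
have le F : \sum_(x <- F) weight x <= W by rewrite -lee_fin -ZW Zpart_ge.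
have [s [_ sW les Hs]] := hasSum_nonneg weight_ge0 le.
have sE : s = W.
  apply/eqP; rewrite eq_le sW /= -lee_fin -ZW; exact: Zpart_le.
exists W => //; split=> //; last by rewrite -sE.
(* The point [x0] makes the partition function positive, so that the division in [gibbs] is a
   genuine one. *)
by apply: lt_le_trans (weight_gt0 x0) _; have := le [fset x0]; rewrite big_seq_fset1.
Qed.

Lemma diag_abs_bounded a m W : ub a m -> (forall F, \sum_(x <- F) weight x <= W) ->
  abs_bounded (fun x => a x x * RtoC (weight x)) (m * W).
Proof.
move=> Ha HW F; apply: le_trans (_ : _ <= m * \sum_(x <- F) weight x) _.
  rewrite mulr_sumr; apply: ler_sum => x _.
  rewrite cmodM (cmodRp (weight_ge0 x)) ler_wpM2r ?weight_ge0//.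
  exact: ub_entry Ha.
by rewrite ler_wpM2l// (ub_ge0 Ha).
Qed.

Lemma gibbs_diff W a b m n : (forall F, \sum_(x <- F) weight x <= W) ->
  Zpart h beta = W%:E -> ub a m -> ub b n ->
  gibbs h beta b - gibbs h beta a =
  sumX (fun x => (b x x - a x x) * RtoC (weight x)) / RtoC W.
Proof.
move=> HW ZW Ha Hb; rewrite /gibbs ZW /= -mulrBl; congr (_ / _).
apply/esym/sumX_eq.
have := hasSumD (abs_bounded_hasSum (diag_abs_bounded Hb HW))
  (hasSumZ (-1) (abs_bounded_hasSum (diag_abs_bounded Ha HW))).
rewrite mulN1r; congr hasSum; apply/funext => x; ring.
Qed.

Lemma gibbs_state : (Zpart h beta < +oo)%E -> is_state d (@gibbs R X h beta).
Proof.
move=> /Zpart_finite[W ZW [W0 HW HsW]]; split.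
- move=> a b /Cu_ub[m Ha] /Cu_ub[n Hb]; rewrite /gibbs -mulrDl; congr (_ / _).
  rewrite -(sumXD (diag_abs_bounded Ha HW) (diag_abs_bounded Hb HW)).
  by congr sumX; apply/funext => x; rewrite /mx_add mulrDl.
- move=> k a /Cu_ub[m Ha]; rewrite /gibbs mulrA; congr (_ / _).
  rewrite -(sumXZ k (diag_abs_bounded Ha HW)).
  by congr sumX; apply/funext => x; rewrite /mx_scale mulrA.
- move=> a /Cu_ub[m Ha].
  (* The diagonal entry of a^* a at [x] is the squared norm of column [x] of [a]. *)
  have pos x : {t : R | mx_mul (mx_adj a) a x x = RtoC t /\ 0 <= t}.
    apply: cid; have := mul_hasSum x x (ub_adj Ha) Ha.
    rewrite (_ : (fun y => _) = fun y => RtoC (cmod (a y x) ^+ 2)); last first.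
      by apply/funext => y; rewrite /mx_adj cmodJM.
    by move=> /hasSum_nonneg_ge[|t [-> t0 _]]; [move=> y; exact: sqr_ge0|exists t].
  pose t x := sval (pos x).
  have tE x : mx_mul (mx_adj a) a x x = RtoC (t x) by have [] := svalP (pos x).
  have t0 x : 0 <= t x by have [] := svalP (pos x).
  have := abs_bounded_hasSum (diag_abs_bounded (ub_mul (ub_adj Ha) Ha) HW).
  rewrite /gibbs ZW /=; set S := sumX _ => HS.
  have HS' : hasSum (fun x => RtoC (t x * weight x)) S.
    by move: HS; congr hasSum; apply/funext => x; rewrite tE RtoCM.
  have [|s [-> s0 _]] := hasSum_nonneg_ge _ HS'.
    by move=> x; rewrite mulr_ge0 ?weight_ge0.
  by rewrite -RtoCV -RtoCM -RtoC0 RtoC_le mulr_ge0// invr_ge0 ltW.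
- rewrite /gibbs ZW /= (_ : (fun x => _) = fun x => RtoC (weight x)).
    by rewrite (sumX_eq HsW) mulfV// -RtoC0 (inj_eq (@RtoC_inj R)) gt_eqF.
  by apply/funext => x; rewrite /mx_one eqxx mul1r.
Qed.

Lemma gibbs_KMS : (Zpart h beta < +oo)%E -> is_KMS d h beta (@gibbs R X h beta).
Proof.
move=> /Zpart_finite[W ZW [W0 HW HsW]] b F Cb ext a Ca.
have [m Ha] := Cu_ub Ca; have [n Hb] := Cu_ub Cb.
have [p HF] := Cu_ub (ext.1.1 ('i * RtoC beta)).
rewrite /gibbs; congr (_ / _).
(* Both sides are iterated sums of this family, because [weight x] times exp(- beta (h y - h x)) is
   [weight y]. *)
pose c x y : C := a x y * b y x * RtoC (weight y).
have -> : (fun x => mx_mul a (F ('i * RtoC beta)) x x * RtoC (weight x)) =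
    fun x => sumX (c x).
  apply/funext => x; apply/esym/sumX_eq; rewrite mulrC.
  have := hasSumZ (RtoC (weight x)) (mul_hasSum x x Ha HF).
  congr hasSum; apply/funext => y; rewrite (entire_ext_beta _ _ beta0 ext) /c.
  have -> : weight y = weight x * expR (- (beta * (h y - h x))).
    by rewrite /weight -expRD; congr expR; ring.
  by rewrite RtoCM; ring.
have -> : (fun x => mx_mul b a x x * RtoC (weight x)) = fun y => sumX (c^~ y).
  apply/funext => y; apply/esym/sumX_eq; rewrite mulrC.
  have := hasSumZ (RtoC (weight y)) (mul_hasSum y y Hb Ha).
  by congr hasSum; apply/funext => x; rewrite /c; ring.
(* For fixed [y], Cauchy-Schwarz on column [y] of [a] and row [y] of [b] gives [m * n]; the weights
   then supply the summability over [y]. *)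
apply: (@fubini _ _ _ _ (m * n * W)) => A B; rewrite exchange_big /=.
have m0 := ub_ge0 Ha; have n0 := ub_ge0 Hb.
apply: (@le_trans _ _ (m * n * \sum_(y <- B) weight y)); last first.
  by rewrite ler_wpM2l ?mulr_ge0.
rewrite mulr_sumr; apply: ler_sum => y _.
rewrite (eq_bigr (fun x => cmod (a x y) * cmod (b y x) * weight y)); last first.
  by move=> x _; rewrite /c !cmodM (cmodRp (weight_ge0 y)).
rewrite -mulr_suml ler_wpM2r ?weight_ge0//.
apply: le_trans (sum_cmod_mul_le A (a^~ y) (b y)) _.
by apply: ler_pM; rewrite ?qnorm_ge0//; [exact: ub_col|exact: ub_row].
Qed.

Definition delta (x : X) : X -> C := fun y => if y == x then 1 else 0.

Lemma l2_delta x : l2 (delta x).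
Proof.
eexists; apply: (@hasSum_point _ _ _ x) => y /negbTE yx.
by rewrite /delta yx normr0 expr0n.
Qed.

Lemma apply_delta a x : mx_apply a (delta x) = a^~ x.
Proof.
apply/funext => y; rewrite /mx_apply (@sumX_point _ _ _ x) /delta ?eqxx ?mulr1//.
by move=> z /negbTE ->; rewrite mulr0.
Qed.

Lemma l2b_col a m x : ub a m -> l2b (a^~ x) m.
Proof. by move=> Ha; split=> [|F]; [exact: ub_ge0 Ha|exact: ub_col]. Qed.

(** A finite set [F] carries almost all of the weight. On [F] the diagonal entries are controlled by
    testing on basis vectors; off [F] the uniform bound [2 * m] meets a small weight. *)
Lemma gibbs_strongly_continuous : (Zpart h beta < +oo)%E ->
  strongly_continuous d (@gibbs R X h beta).
Proof.
move=> /Zpart_finite[W ZW [W0 HW HsW]] B BC [M HM] a Ba _ /gt0_RtoC[r -> r0].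
have [m Mm _] := op_boundP (HM _ Ba); rewrite {}Mm in HM.
have {}HM b : B b -> ub b m by move=> /HM /op_bound_ub.
have m0 := ub_ge0 (HM _ Ba).
(* With this tail the part off [F] contributes less than [r * W / 2]; the part on [F] contributes at
   most [r / 2 * W]. *)
have eta0 : 0 < r * W / (4 * (m + 1)) by rewrite divr_gt0 ?mulr_gt0//; lra.
have /hasSumP/(_ _ eta0)[F /(_ F (fsubset_refl _))] := HsW.
rewrite -RtoC_sum -RtoCB cmodR distrC ger0_norm ?subr_ge0// => HF.
exists [seq delta x | x <- F], (RtoC (r / 2)); split.
- by apply/allP => _ /mapP[x _ ->]; apply/asboolP; exact: l2_delta.
- by rewrite -RtoC0 RtoC_lt divr_gt0.
move=> b Bb H.
have Hab := ub_sub (HM _ Bb) (HM _ Ba).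
have small x : x \in F -> cmod (b x x - a x x) <= r / 2.
  move=> xF; have := H _ (map_f _ xF); rewrite apply_delta.
  have [t [-> t0 _ _ Ht]] := l2b_norm2 (l2b_col x Hab).
  rewrite -RtoCX RtoC_lt => tr; rewrite -(@ler_pXn2r _ 2)// ?nnegrE ?cmod_ge0 ?divr_ge0 ?(ltW r0)//.
  by have := Ht [fset x]; rewrite big_seq_fset1 /mx_sub => /le_trans; apply; exact: ltW.
rewrite normE RtoC_lt (gibbs_diff HW ZW (HM _ Ba) (HM _ Bb)).
rewrite cmodM cmodV (cmodRp (ltW W0)) ltr_pdivrMr//.
apply: (@le_lt_trans _ _ (r / 2 * W + 2 * m * (r * W / (4 * (m + 1))))); last first.
  have -> : 2 * m * (r * W / (4 * (m + 1))) = r * W / 2 * (m / (m + 1)).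
    by field; rewrite gt_eqF//; lra.
  have rW : 0 < r * W by exact: mulr_gt0.
  have : m / (m + 1) < 1 by rewrite ltr_pdivrMr; lra.
  by nra.
apply: sumX_cmod_le => G.
apply: (@le_trans _ _ (\sum_(x <- G) (r / 2 * weight x + (if x \in F then 0 else 2 * m * weight x)))).
  apply: ler_sum => x _; rewrite cmodM (cmodRp (weight_ge0 x)).
  case: ifP => [/small|_]; first by rewrite addr0 => ?; rewrite ler_wpM2r ?weight_ge0.
  have := ub_entry x x Hab; rewrite /mx_sub => hx.
  have wx := weight_ge0 x; have : 0 <= r / 2 * weight x by rewrite mulr_ge0// divr_ge0// ltW.
  by nra.
rewrite big_split /= -mulr_sumr; apply: lerD.
  by rewrite ler_wpM2l// divr_ge0// ltW.
have -> : \sum_(x <- G) (if x \in F then 0 else 2 * m * weight x) =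
   2 * m * \sum_(x <- G) (if x \in F then 0 else weight x).
  by rewrite mulr_sumr; apply: eq_bigr => x _; case: ifP; rewrite ?mulr0.
rewrite ler_wpM2l ?mulr_ge0//; apply: le_trans (ltW HF).
rewrite lerBrDl; apply: le_trans (HW (F `|` G)).
rewrite -(sum_cutoff _ (fsubsetUl F G)).
have g0 x : 0 <= (if x \in F then 0 else weight x) by case: ifP => _; rewrite ?weight_ge0.
apply: le_trans (lerD (lexx _) (le_fsum g0 (fsubsetUr F G))) _.
rewrite -big_split /=; apply: ler_sum => x _.
by case: ifP; rewrite ?addr0 ?add0r.
Qed.

End Gibbs.

(** * Uniqueness of KMS states *)

Section Uniqueness.
Variables (R : realType) (X : choiceType) (x0 : X) (d : X -> X -> R) (h : X -> R) (beta : R).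
Hypothesis dm : is_metric d.
Hypothesis beta0 : 0 <= beta.
Local Notation C := R[i].
Local Notation mx := (mx R X).
Local Notation w := (weight h beta).
Implicit Types (F G : {fset X}) (a b : mx) (m n s : R) (k : C).

Lemma mul_mxunitr a x z i j : mx_mul a (mxunit R x z) i j = if j == z then a i x else 0.
Proof.
rewrite /mx_mul (@sumX_point _ _ _ x) /mxunit ?eqxx /=.
  by case: (j == z); rewrite ?mulr1 ?mulr0.
by move=> y /negbTE ->; rewrite mulr0.
Qed.

Lemma mul_mxunitl a z x i j : mx_mul (mxunit R z x) a i j = if i == z then a x j else 0.
Proof.
rewrite /mx_mul (@sumX_point _ _ _ x) /mxunit ?eqxx ?andbT /=.
  by case: (i == z); rewrite ?mul1r ?mul0r.
by move=> y /negbTE ->; rewrite andbF mul0r.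
Qed.

(** * Values of a KMS state on matrix units and on finitely many columns *)

Section KMS.
Variable phi : mx -> C.
Hypothesis phi_state : is_state d phi.
Hypothesis phi_KMS : is_KMS d h beta phi.

Lemma KMS_mxunit a x y : Cu d a ->
  phi (mx_mul a (mx_scale (RtoC (expR (- (beta * (h x - h y))))) (mxunit R x y))) =
  phi (mx_mul (mxunit R x y) a).
Proof.
move=> Ca; have ext := mxunit_entire_ext d h x y.
rewrite -(phi_KMS (Cu_mxunit d x y) ext Ca); congr (phi (mx_mul a _)).
(* Applied to the explicit extension, [entire_ext_beta] also evaluates it at i beta. *)
apply/funext => i; apply/funext => j; rewrite (entire_ext_beta i j beta0 ext).
rewrite /mx_scale /mxunit; case: andP => [[/eqP -> /eqP ->]//|_].
by rewrite !mulr0.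
Qed.

(** Write e_xx = e_xy e_yx; moving e_xy to the right by the KMS condition yields the scalar times
    e_yx e_xy = e_yy. *)
Lemma phi_unit_ratio x y :
  phi (mxunit R x x) = RtoC (expR (- (beta * (h x - h y)))) * phi (mxunit R y y).
Proof.
case: phi_state => _ phiZ _ _.
rewrite -phiZ; last exact: Cu_mxunit.
have -> : mxunit R x x = mx_mul (mxunit R x y) (mxunit R y x).
  by apply/funext => i; apply/funext => j; rewrite mul_mxunitl /mxunit eqxx /=; case: (i == x).
rewrite -KMS_mxunit; last exact: Cu_mxunit.
congr (phi _); apply/funext => i; apply/funext => j.
by rewrite mul_mxunitl /mx_scale /mxunit eqxx /=; case: (i == y); rewrite ?mulr0.
Qed.

(** The factor attached to e_xx is 1, so e_xx can be moved freely: phi(a e_xx) = phi(e_xx a e_xx),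
    and e_xx a e_xx is a scalar multiple of e_xx. *)
Lemma phi_col a x : Cu d a ->
  phi (colr a (pred1 x)) = a x x * phi (mxunit R x x).
Proof.
case: phi_state => _ phiZ _ _ Ca.
rewrite -phiZ; last exact: Cu_mxunit.
have := @KMS_mxunit (colr a (pred1 x)) x x (Cu_colr _ Ca).
rewrite subrr mulr0 oppr0 expR0 => H.
transitivity (phi (mx_mul (colr a (pred1 x)) (mx_scale (RtoC 1) (mxunit R x x)))).
  congr phi; apply/funext => i; apply/funext => j.
  have -> : mx_scale (RtoC 1) (mxunit R x x) = mxunit R x x.
    by apply/funext => p; apply/funext => q; rewrite /mx_scale mul1r.
  by rewrite mul_mxunitr /colr /= eqxx; case: eqP => [->|].
rewrite H; congr phi; apply/funext => i; apply/funext => j.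
rewrite mul_mxunitl /colr /mx_scale /mxunit /=.
by case: (j =P x) => [->|_]; case: (i == x); rewrite /= ?mulr1 ?mulr0.
Qed.

Lemma phi_cols a F : Cu d a ->
  phi (colr a (mem F)) = \sum_(x <- F) a x x * phi (mxunit R x x).
Proof.
case: phi_state => phiD phiZ _ _ Ca.
elim/finSet_rect: F => F IH; have [->|[x xF]] := fset_0Vmem F.
  rewrite big_seq_fset0; have := phiZ 0 _ Ca; rewrite mul0r => <-; congr phi.
  by apply/funext => i; apply/funext => j; rewrite /colr /mx_scale mul0r /=.
rewrite (big_fsetD1 x) //= -phi_col// -(IH (F `\ x)) ?fproperD1//.
rewrite -phiD; [|exact: Cu_colr|exact: Cu_colr]; congr phi.
apply/funext => i; apply/funext => j; rewrite /mx_add /colr /= in_fsetD1.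
by case: eqP => [->|_] /=; rewrite ?xF ?addr0 ?add0r.
Qed.

(** The vector is the negated tail of [xi] because subtracting [a] from its compression to the
    columns in [F] leaves [a] applied to that vector. *)
Lemma tail_small (xi : X -> C) (eta : R) : l2 xi -> 0 < eta ->
  exists F0 : {fset X}, forall F, F0 `<=` F ->
    l2b (fun y => if y \in F then 0 else - xi y) (Num.sqrt eta).
Proof.
move=> /l2_l2b[s /l2b_norm2[t [_ t0 _ /hasSumP Ht le]]] e0.
have [F0 HF0] := Ht _ e0; exists F0 => F /HF0.
rewrite -RtoC_sum -RtoCB cmodR distrC ger0_norm ?subr_ge0// => HF.
split=> [|G]; first exact: sqrtr_ge0.
rewrite qnorm_le ?sqrtr_ge0// sqr_sqrtr ?(ltW e0)//.
apply: le_trans (ltW HF); rewrite lerBrDl; apply: le_trans (le (F `|` G)).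
rewrite -(sum_cutoff _ (fsubsetUl F G)).
have g0 x : 0 <= cmod (if x \in F then 0 else - xi x) ^+ 2 by exact: sqr_ge0.
apply: le_trans (lerD (lexx _) (le_fsum g0 (fsubsetUr F G))) _.
rewrite -big_split /=; apply: ler_sum => x _.
by case: ifP; rewrite ?cmod0 ?expr0n ?cmodN ?addr0 ?add0r.
Qed.

Lemma cols_strong_limit a m (xis : seq (X -> C)) (del : R) : ub a m -> 0 < del ->
  (forall xi, xi \in xis -> l2 xi) ->
  exists F0 : {fset X}, forall F, F0 `<=` F -> forall xi, xi \in xis ->
    l2norm2 (mx_apply (mx_sub (colr a (mem F)) a) xi) < RtoC del ^+ 2.
Proof.
move=> Ha d0; elim: xis => [|xi xis IH] H; first by exists fset0.
have [|F1 H1] := IH; first by move=> z zx; apply: H; rewrite inE zx orbT.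
have m1 : 0 < m ^+ 2 + 1 by have := sqr_ge0 m; lra.
(* Applying [a] multiplies the squared norm by at most [m ^+ 2], which stays below [del ^+ 2]. *)
have eta0 : 0 < del ^+ 2 / (m ^+ 2 + 1) by rewrite divr_gt0 ?exprn_gt0.
have [F2 H2] := tail_small (H xi (mem_head _ _)) eta0.
exists (F1 `|` F2) => F /fsubUsetP[/H1 h1 /H2 h2] z; rewrite inE => /predU1P[->|]; last exact: h1.
have -> : mx_apply (mx_sub (colr a (mem F)) a) xi =
    mx_apply a (fun y => if y \in F then 0 else - xi y).
  apply/funext => x; rewrite /mx_apply; congr sumX; apply/funext => y.
  by rewrite /mx_sub /colr /=; case: ifP => _; ring.
have [t [-> t0 tle _ _]] := l2b_norm2 (l2b_apply Ha h2).
rewrite -RtoCX RtoC_lt (le_lt_trans tle)// exprMn sqr_sqrtr ?(ltW eta0)//.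
by rewrite mulrCA gtr_pMr ?exprn_gt0// ltr_pdivrMr//; lra.
Qed.

Hypothesis phi_cont : strongly_continuous d phi.

Lemma phi_hasSum a : Cu d a ->
  hasSum (fun x => a x x * phi (mxunit R x x)) (phi a).
Proof.
move=> Ca; have [m Ha] := Cu_ub Ca; apply/hasSumP => e e0.
(* Strong continuity only holds on bounded sets; [a] and all its column compressions share the bound
   [m]. *)
pose B : set mx := [set b | b = a \/ exists F, b = colr a (mem F)].
have e0' : 0 < RtoC e by rewrite -RtoC0 RtoC_lt.
have [|||xis [_ [/allP xl /gt0_RtoC[del -> d0] H]]] := phi_cont (B := B) _ _ (a := a) _ e0'.
- by move=> b [->//|[F ->]]; exact: Cu_colr.
- exists (RtoC m) => b [->|[F ->]]; apply/op_bound_ub => //; exact: ub_colr.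
- by left.
have [|F0 HF0] := cols_strong_limit Ha d0 (xis := xis).
  by move=> xi /xl /asboolP.
exists F0 => F /HF0 HF; rewrite -phi_cols// -RtoC_lt -normE.
by apply: H => //; right; exists F.
Qed.

Lemma phi_gibbs : (Zpart h beta < +oo)%E /\
  forall a, Cu d a -> phi a = gibbs h beta a.
Proof.
have [_ _ phi_pos phi1] := phi_state.
(* The common ratio of phi(e_xx) to the weight at [x], computed at [x0]. *)
pose k := RtoC (expR (beta * h x0)) * phi (mxunit R x0 x0).
have pE x : phi (mxunit R x x) = RtoC (w x) * k.
  rewrite (phi_unit_ratio x x0) /k mulrA -RtoCM -expRD /weight; congr (RtoC (expR _) * _).
  by ring.
have [r kr r0] : exists2 r, k = RtoC r & 0 <= r.
  apply: ge0_RtoC; apply: mulr_ge0; first by rewrite -RtoC0 RtoC_le expR_ge0.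
  have := phi_pos _ (Cu_mxunit d x0 x0); congr (0 <= phi _).
  apply/funext => i; apply/funext => j; rewrite mul_mxunitr /mx_adj /mxunit eqxx /=.
  by case: (j == x0); case: (i == x0); rewrite ?conjC1 ?conjC0.
have H1 := phi_hasSum (Cu_one dm).
have {}H1 : hasSum (fun x => k * RtoC (w x)) 1.
  rewrite -phi1; move: H1; congr hasSum; apply/funext => x.
  by rewrite /mx_one eqxx mul1r pE mulrC.
have k0 : k != 0.
  apply/eqP => k0; have := hasSum_unique H1 (S := 1) (T := 0).
  rewrite k0; have := @hasSum_finite R X (fun x => 0 * RtoC (w x)) fset0.
  rewrite big_seq_fset0 => h0 /(_ (h0 (fun _ _ => mul0r _)))/eqP.
  by rewrite oner_eq0.
(* Finiteness of the partition function is a conclusion here: phi(1) = 1 already makes the weights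
   summable, with sum 1 / k. *)
have Hw : hasSum (fun x => RtoC (w x)) k^-1.
  have := hasSumZ k^-1 H1; rewrite mulr1; congr hasSum.
  by apply/funext => x; rewrite mulrA mulVf// mul1r.
have [s [_ s0 Hs]] := hasSum_nonneg_ge (weight_ge0 h beta) Hw.
have Zfin : (Zpart h beta < +oo)%E by apply: le_lt_trans (Zpart_le Hs) _; rewrite ltry.
split=> // a Ca; have [m Ha] := Cu_ub Ca.
have [W ZW [W0 HW HsW]] := Zpart_finite x0 Zfin.
rewrite /gibbs ZW /= -(hasSum_unique Hw HsW) invrK mulrC.
apply: hasSum_unique (phi_hasSum Ca) _.
have := hasSumZ k (abs_bounded_hasSum (diag_abs_bounded Ha HW)).
by congr hasSum; apply/funext => x; rewrite pE; ring.
Qed.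

End KMS.

(** A [phi] in the theorem is a function on all matrices and is only prescribed on [Cu d]. Every
    condition evaluates it inside [Cu d], by the closure properties of that algebra. *)
Lemma eq_sc_KMS_state (phi psi : mx -> C) : (forall a, Cu d a -> phi a = psi a) ->
  sc_KMS_state d h beta psi -> sc_KMS_state d h beta phi.
Proof.
move=> E [[sD sZ sp s1] sc kms]; split; first split.
- by move=> a b Ca Cb; rewrite !E ?sD//; exact: Cu_add.
- by move=> k a Ca; rewrite !E ?sZ//; exact: Cu_scale.
- by move=> a Ca; rewrite E ?sp//; apply: Cu_mul => //; exact: Cu_adj.
- by rewrite E ?s1//; exact: Cu_one.
- move=> B BC BM a Ba e e0; have [xis [del [l2s d0 H]]] := sc B BC BM a Ba e e0.
  exists xis, del; split=> // b Bb Hb.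
  by rewrite !E; [exact: H|exact: BC|exact: BC].
- move=> b F Cb ext a Ca; rewrite !E; [exact: (kms b F)|exact: Cu_mul|].
  apply: Cu_mul => //; exact: ext.1.1.
Qed.

End Uniqueness.

Theorem theorem1p6 (R : realType) (X : choiceType) (x0 : X)
  (d : X -> X -> R) (h : X -> R) (beta : R) :
  is_metric d -> ulf d -> coarse d h -> 0 <= beta ->
  [/\ (exists phi : mx R X -> R[i], sc_KMS_state d h beta phi) <->
        (Zpart h beta < +oo)%E,
      (Zpart h beta < +oo)%E ->
        forall phi : mx R X -> R[i],
          sc_KMS_state d h beta phi <-> (forall a, Cu d a -> phi a = gibbs h beta a) &
      forall phi1 phi2 : mx R X -> R[i],
        sc_KMS_state d h beta phi1 -> sc_KMS_state d h beta phi2 ->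
        forall a, Cu d a -> phi1 a = phi2 a].
Proof.
move=> dm _ _ beta0.
have gibbs_ok : (Zpart h beta < +oo)%E -> sc_KMS_state d h beta (@gibbs R X h beta).
  move=> Zfin; split; [exact: gibbs_state|exact: gibbs_strongly_continuous|exact: gibbs_KMS].
have uniq phi : sc_KMS_state d h beta phi ->
    (Zpart h beta < +oo)%E /\ forall a, Cu d a -> phi a = gibbs h beta a.
  by case=> st sc kms; exact: (phi_gibbs x0 dm beta0 st kms sc).
split.
- split=> [[phi /uniq[]//]|Zfin]; exists (@gibbs R X h beta); exact: gibbs_ok.
- move=> Zfin phi; split=> [/uniq[]//|E].
  by apply: (eq_sc_KMS_state dm E); exact: gibbs_ok.
- by move=> phi1 phi2 /uniq[_ E1] /uniq[_ E2] a Ca; rewrite E1// E2.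
Qed.
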